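(* Let $2\le m\le n$ and let $n_1,\dots,n_m\geq 1$ be integers with $n=n_1+n_2+\dots+n_m$. For each $i=1,\dots,m$ let $D_i\subset\mathbf{C}^{n_i}$ be a bounded strongly convex domain with $C^6$-smooth boundary. Let $\mathbf{B}^n$ be the Euclidean unit ball in $\mathbf{C}^n$. There is no $C^1$-Kobayashi isometry and no $C^1$-Carathéodory isometry between $\mathbf{B}^n$ and the product $D_1\times D_2\times\dots\times D_m$.
   Context: $\Delta$ is the open unit disc in $\mathbf{C}$. For a domain $D\subset\mathbf{C}^n$, $z\in D$ and $\xi\in\mathbf{C}^n$, the infinitesimal Kobayashi and Carathéodory metrics are $$F^K_D(z,\xi)=\inf\{1/\alpha:\alpha>0,\ \exists f:\Delta\to D\text{ holomorphic},\ f(0)=z,\ f'(0)=\alpha\xi\},$$ $$F^C_D(z,\xi)=\sup\{|df(z)\xi|: f:D\to\Delta\text{ holomorphic}\}.$$ A $C^1$-Kobayashi isometry between domains $D_1,D_2$ is a $C^1$-diffeomorphism $f$ from $D_1$ onto $D_2$ (not assumed holomorphic) with $f^*(F^K_{D_2})=F^K_{D_1}$, i.e. $F^K_{D_2}(f(z),df(z)\xi)=F^K_{D_1}(z,\xi)$ for all $z\in D_1$ and all tangent vectors $\xi$ at $z$ (tangent vectors being identified with elements of $\mathbf{C}^n$ and $df(z)$ being the real differential). A $C^1$-Carathéodory isometry is defined in the same way with $F^C$ in place of $F^K$. A domain $D\subset\mathbf{C}^k$ with $C^2$-smooth boundary is strongly convex if there is a defining function $\rho$ for $\partial D$ whose real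 Hessian is positive definite as a bilinear form on $T_p(\partial D)$ for every $p\in\partial D$. *)

(* Defs.v *)
From mathcomp Require Export all_boot all_order all_algebra.
From mathcomp Require Export all_classical all_reals all_analysis.
From mathcomp Require Export complex.
Export numFieldNormedType.Exports.

Set Implicit Arguments.
Unset Strict Implicit.
Unset Printing Implicit Defensive.

Import Order.TTheory GRing.Theory Num.Theory.

Local Open Scope classical_set_scope.
Local Open Scope ring_scope.
Local Open Scope complex_scope.

(* The named numClosedFieldType (rather than the bare type R[i]) is what lets
   the topology and norm of C and of 'rV[C]_n be inferred.  As usual for
   matrices, 'rV[C]_n carries the sup norm; only its topology matters below. *)
Definition cplx (R : realType) : numClosedFieldType := R[i].

Definition realify (R : realType) n (z : 'rV[cplx R]_n) : 'rV[R]_(n + n) :=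
  row_mx (\row_j complex.Re (z 0 j)) (\row_j complex.Im (z 0 j)).

Definition complexify (R : realType) n (x : 'rV[R]_(n + n)) : 'rV[cplx R]_n :=
  \row_j (lsubmx x 0 j +i* rsubmx x 0 j).

Lemma realifyK (R : realType) n : cancel (@realify R n) (@complexify R n).
Proof.
move=> z; apply/rowP => j; rewrite mxE /realify row_mxKl row_mxKr !mxE.
by case: (z 0 j : complex R).
Qed.

Lemma complexifyK (R : realType) n : cancel (@complexify R n) (@realify R n).
Proof.
move=> x; rewrite -[RHS]hsubmxK /realify.
by congr row_mx; apply/rowP => j; rewrite !mxE.
Qed.

Definition realset (R : realType) n (D : set 'rV[cplx R]_n) :
  set 'rV[R]_(n + n) := @complexify R n @^-1` D.

Definition realmap (R : realType) n1 n2 (f : 'rV[cplx R]_n1 -> 'rV[cplx R]_n2) :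
    'rV[R]_(n1 + n1) -> 'rV[R]_(n2 + n2) :=
  @realify R n2 \o f \o @complexify R n1.

(* The real differential df(z), conjugated by the coordinates so that it acts
   on tangent vectors seen in C^n; it need not be C-linear. *)
Definition rdiff (R : realType) n1 n2 (f : 'rV[cplx R]_n1 -> 'rV[cplx R]_n2)
    (z xi : 'rV[cplx R]_n1) : 'rV[cplx R]_n2 :=
  complexify ('d (realmap f) (realify z) (realify xi)).

(* To be used with U open.  In finite dimension, x |-> 'd f x is of class C^k
   for the operator norm iff x |-> 'd f x v is of class C^k for every v. *)
Fixpoint Ck (R : realType) N (W : normedModType R) (k : nat)
    (U : set 'rV[R]_N) (f : 'rV[R]_N -> W) : Prop :=
  match k with
  | 0 => forall x, U x -> {for x, continuous f}
  | k'.+1 => (forall x, U x -> differentiable f x) /\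
             (forall v, Ck k' U (fun x => 'd f x v))
  end.

Definition boundary (T : topologicalType) (D : set T) : set T :=
  closure D `\` interior D.

(* The fourth clause makes U a neighbourhood of the boundary of D. *)
Definition defining_function (R : realType) N (k : nat) (D U : set 'rV[R]_N)
    (rho : 'rV[R]_N -> R) : Prop :=
  [/\ open U,
      Ck k U rho,
      D `&` U = [set x | U x /\ rho x < 0],
      boundary D = [set x | U x /\ rho x = 0]
    & forall p, boundary D p -> exists v, 'd rho p v != 0].

Definition smooth_boundary (R : realType) n (k : nat)
    (D : set 'rV[cplx R]_n) : Prop :=
  exists U rho, defining_function k (realset D) U rho.

Definition hessian (R : realType) N (rho : 'rV[R]_N -> R)
    (p v w : 'rV[R]_N) : R :=
  'd (fun x => 'd rho x v) p w.

(* The tangent space of the boundary at p is the kernel of 'd rho p. *)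
Definition strongly_convex (R : realType) n (D : set 'rV[cplx R]_n) : Prop :=
  exists U rho, defining_function 2 (realset D) U rho /\
    forall p, boundary (realset D) p ->
    forall v, 'd rho p v = 0 -> v != 0 -> 0 < hessian rho p v v.

Definition is_domain (R : realType) n (D : set 'rV[cplx R]_n) : Prop :=
  [/\ open D, connected D & D !=set0].

Definition unit_disc (R : realType) : set (cplx R) := [set z | `|z| < 1].

Definition unit_ball (R : realType) n : set 'rV[cplx R]_n :=
  [set z | \sum_(j < n) `|z 0 j| ^+ 2 < 1].

(* C^(N 0 + ... + N (m-1)) is identified with the product of the C^(N i) by
   MathComp's block decomposition of row vectors. *)
Definition product_domain (R : realType) m (N : 'I_m -> nat)
    (D : forall i, set 'rV[cplx R]_(N i)) : set 'rV[cplx R]_(\sum_(i < m) N i) :=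
  [set z | forall i, D i (submxrow z i)].

(* 'd is here the Frechet differential over the field C; D is meant open. *)
Definition holomorphic (R : realType) (V W : normedModType (cplx R))
    (D : set V) (f : V -> W) : Prop :=
  forall z, D z -> differentiable f z.

(* When D is a bounded domain containing z, the sets of reals in the two metrics
   below are nonempty and bounded, so that inf and sup take their true values
   rather than the default value 0. *)
Definition kobayashi (R : realType) n (D : set 'rV[cplx R]_n)
    (z xi : 'rV[cplx R]_n) : R :=
  inf [set r | exists a : R, [/\ 0 < a, r = a^-1 &
    exists f : cplx R -> 'rV[cplx R]_n,
      [/\ holomorphic (@unit_disc R) f,
          f @` @unit_disc R `<=` D,
          f 0 = z
        & derive1 f 0 = (a%:C : cplx R) *: xi]]].

Definition caratheodory (R : realType) n (D : set 'rV[cplx R]_n)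
    (z xi : 'rV[cplx R]_n) : R :=
  sup [set r | exists f : 'rV[cplx R]_n -> cplx R,
    [/\ holomorphic D f,
        f @` D `<=` @unit_disc R
      & (r%:C : cplx R) = `|'d f z xi|]].

Definition C1_diffeo (R : realType) n1 n2 (D1 : set 'rV[cplx R]_n1)
    (D2 : set 'rV[cplx R]_n2) (f : 'rV[cplx R]_n1 -> 'rV[cplx R]_n2) : Prop :=
  exists g : 'rV[cplx R]_n2 -> 'rV[cplx R]_n1,
    [/\ f @` D1 = D2,
        {in D1, cancel f g},
        Ck 1 (realset D1) (realmap f)
      & Ck 1 (realset D2) (realmap g)].

Definition C1_isometry (R : realType)
    (F : forall n, set 'rV[cplx R]_n -> 'rV[cplx R]_n -> 'rV[cplx R]_n -> R)
    n1 n2 (D1 : set 'rV[cplx R]_n1) (D2 : set 'rV[cplx R]_n2)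
    (f : 'rV[cplx R]_n1 -> 'rV[cplx R]_n2) : Prop :=
  C1_diffeo D1 D2 f /\
  forall z xi, D1 z -> F n2 D2 (f z) (rdiff f z xi) = F n1 D1 z xi.

Definition C1_kobayashi_isometry (R : realType) n1 n2 :=
  @C1_isometry R (@kobayashi R) n1 n2.

Definition C1_caratheodory_isometry (R : realType) n1 n2 :=
  @C1_isometry R (@caratheodory R) n1 n2.

(* Main.v *)
Require Import Defs.
From mathcomp Require Import ring lra.

(** The infinitesimal metric of the ball at any point is a Hilbert norm, hence
    satisfies the parallelogram law, and this is inherited by the metric of the
    product through the (real linear, surjective) differential of an isometry.
    Let [q_i] be a point of the closure of [D_i] farthest from the origin.  The
    half-space supported at [q_i] bounds the metrics of [D_i] at
    [(1 - eps) q_i] in the direction [q_i] from below by [1 / (2 eps)].  Since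
    the boundary is [C^1] at [q_i], for small [eps] the domain contains the discs
    [q_i - eps psi(z) q_i] with [psi(z) = (1 + r z) / (1 - r z)], [r = 3/4].
    Using such discs in two factors simultaneously, the metric of the product
    in the directions [q_1 + q_2] and [q_1 - q_2] is at most [1 / (2 r eps)];
    the parallelogram law would then give [r ^ 2 <= 1 / 2].

    Both metrics are handled at once because each of them lies between the
    derivatives of bounded functions and the inverse radii of discs.  This
    sandwich is Cauchy's estimate for maps that are merely complex
    differentiable, which is obtained from Goursat's theorem on rectangles,
    applied to [f(exp w) exp(- w)]. *)

Set Implicit Arguments.
Unset Strict Implicit.
Unset Printing Implicit Defensive.
Import Order.TTheory GRing.Theory Num.Theory.
Local Open Scope classical_set_scope.
Local Open Scope ring_scope.

(** * Goursat's theorem on rectangles *)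

Section SegmentIntegral.
Variable R : realType.
Implicit Types (w : R -> R) (a b c e k : R).

Definition cont_on w a b := forall x, a <= x <= b -> {for x, continuous w}.

Definition intc w a b : R := \int[lebesgue_measure]_(x in `[a, b]) w x.

Lemma cont_on_integrable w a b :
  cont_on w a b -> lebesgue_measure.-integrable `[a, b] (EFin \o w).
Proof.
move=> h; apply: continuous_compact_integrable; first exact: segment_compact.
apply: continuous_in_subspaceT => x; rewrite inE /= in_itv /= => xab.
exact: h.
Qed.

Lemma intc_split w a b c : a <= c -> c <= b -> cont_on w a b ->
  intc w a b = intc w a c + intc w c b.
Proof.
move=> ac cb h; have hi := cont_on_integrable h.
have := @Rintegral_itvB _ w (BLeft a) (BRight b) c hi.
rewrite !bnd_simp ac cb => /(_ isT isT) e.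
have hi2 : lebesgue_measure.-integrable `]c, b] (EFin \o w).
  apply: integrableS hi => //; apply: subset_itvr; rewrite bnd_simp //.
move: e; rewrite Rintegral_itv_obnd_cbnd // => e.
by rewrite /intc -e addrC subrK.
Qed.

(** The only integral estimate of the development: it serves both for the local bound in Goursat's
    theorem and for the two circle means in Cauchy's estimate. *)
Lemma intc_near_cst w a b k e : a <= b -> cont_on w a b ->
  (forall x, a <= x <= b -> `|w x - k| <= e) ->
  `|intc w a b - k * (b - a)| <= e * (b - a).
Proof.
move=> ab h hk; have hi := cont_on_integrable h.
have hc (r : R) : lebesgue_measure.-integrable `[a, b] (EFin \o cst r).
  by apply: cont_on_integrable => x _; exact: cst_continuous.
have ic (r : R) : \int[lebesgue_measure]_(x in `[a, b]) (cst r x) = r * (b - a).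
  by rewrite Rintegral_cst //= lebesgue_measure_itv /= lte_fin; case: ltP => //=
     ; rewrite /fine => ba; have -> : a = b by [apply/eqP; rewrite eq_le ab ba];
     rewrite subrr.
rewrite ler_norml -!ic.
apply/andP; split.
  rewrite lerBrDr !ic -mulNr -mulrDl -ic; apply: le_Rintegral => // x /=.
  by rewrite in_itv /= => /hk; rewrite ler_norml => /andP[]; lra.
rewrite lerBlDr !ic -mulrDl -ic; apply: le_Rintegral => // x /=.
by rewrite in_itv /= => /hk; rewrite ler_norml => /andP[]; lra.
Qed.

Lemma intcB w1 w2 a b : cont_on w1 a b -> cont_on w2 a b ->
  intc (fun x => w1 x - w2 x) a b = intc w1 a b - intc w2 a b.
Proof.
by move=> h1 h2; apply: RintegralB => //; exact: cont_on_integrable.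
Qed.

End SegmentIntegral.

Section Goursat.
Variable R : realType.
Variables u v : R -> R -> R.

(** Total differentiability at (x, y) with partial derivatives A and B, spelled out in the l^1 norm
    of the plane. *)
Definition expansion (w : R -> R -> R) (x y A B : R) :=
  forall e, 0 < e -> exists2 d, 0 < d & forall s t,
    `|s - x| < d -> `|t - y| < d ->
    `|w s t - w x y - (A * (s - x) + B * (t - y))| <= e * (`|s - x| + `|t - y|).

(** Here A + i B is the complex derivative of u + i v: u_x = v_y = A and v_x = - u_y = B. *)
Definition cauchy_riemann x y := exists A B,
  expansion u x y A (- B) /\ expansion v x y B A.

Lemma expansion_cont1 w x y A B : expansion w x y A B ->
  {for x, continuous (fun s => w s y)}.
Proof.
move=> h; apply/cvgrPdist_lt => e e0.
have [d d0 hd] := h 1 ltr01.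
near=> s.
have hs : `|s - x| < d by near: s; apply: cvgr_distC_lt.
have hs2 : `|s - x| < e / (2 + `|A|).
  near: s; apply: cvgr_distC_lt => //; apply: divr_gt0 => //; have := normr_ge0 A; lra.
have := hd s y hs; rewrite subrr normr0 => /(_ d0).
rewrite mulr0 !addr0 mul1r => h1.
have hA : `|A * (s - x)| = `|A| * `|s - x| by rewrite normrM.
rewrite distrC; have : `|w s y - w x y| <= `|s - x| + `|A| * `|s - x|.
  rewrite -hA -lerBlDr; apply: le_trans h1; exact: lerB_dist.
move=> /le_lt_trans; apply.
have hA0 := normr_ge0 A; have := normr_ge0 (s - x).
move: hs2; rewrite ltr_pdivlMr; last by lra.
set X := `|s - x|; set Y := `|A| in hA0 *; nra.
Unshelve. all: by end_near.
Qed.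

Lemma expansion_swap w x y A B :
  expansion w x y A B -> expansion (fun s t => w t s) y x B A.
Proof.
move=> h e e0; have [d d0 hd] := h e e0; exists d => // s t hs ht.
by rewrite [B * _ + _]addrC [`|s - y| + _]addrC; exact: hd.
Qed.

Lemma expansion_cont2 w x y A B : expansion w x y A B ->
  {for y, continuous (fun t => w x t)}.
Proof. by move/expansion_swap/expansion_cont1. Qed.

(* The circulation of v ds + u dt along the boundary of the rectangle
   [a, a + S] x [b, b + T]. *)
Definition circ a b S T :=
  (intc (u (a + S)) b (b + T) - intc (u a) b (b + T))
  - (intc (v ^~ (b + T)) a (a + S) - intc (v ^~ b) a (a + S)).

Definition cr_on a b S T := forall x y,
  a <= x <= a + S -> b <= y <= b + T -> cauchy_riemann x y.

Lemma cr_on_u a b S T x : cr_on a b S T -> a <= x <= a + S ->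
  cont_on (u x) b (b + T).
Proof. by move=> h hx y hy; have [A [B [/expansion_cont2]]] := h x y hx hy. Qed.

Lemma cr_on_v a b S T y : cr_on a b S T -> b <= y <= b + T ->
  cont_on (v ^~ y) a (a + S).
Proof. by move=> h hy x hx; have [A [B [_ /expansion_cont1]]] := h x y hx hy. Qed.

(** Each inner edge belongs to two quarters with opposite orientations and cancels; the outer edges
    are split at their midpoints. *)
Lemma circ_quarter a b S T : 0 <= S -> 0 <= T ->
  cr_on a b (S + S) (T + T) ->
  circ a b (S + S) (T + T) =
  circ a b S T + circ (a + S) b S T + circ a (b + T) S T
  + circ (a + S) (b + T) S T.
Proof.
move=> S0 T0 h; rewrite /circ -!addrA !addrA.
have hu x : a <= x <= a + (S + S) -> intc (u x) b (b + T + T) =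
   intc (u x) b (b + T) + intc (u x) (b + T) (b + T + T).
  by move=> hx; apply: intc_split; [lra|lra|rewrite -addrA; exact: cr_on_u h hx].
have hv y : b <= y <= b + (T + T) -> intc (v ^~ y) a (a + S + S) =
   intc (v ^~ y) a (a + S) + intc (v ^~ y) (a + S) (a + S + S).
  by move=> hy; apply: intc_split; [lra|lra|rewrite -addrA; exact: cr_on_v h hy].
rewrite !hu; [|lra|lra]. rewrite !hv; [|lra|lra].
lra.
Qed.

(** Up to 2 e (S + T), [u] changes by A S between the vertical edges and [v] by A T between the
    horizontal ones. Integrated over lengths T and S, these main terms cancel, and only the errors
    remain. *)
Lemma circ_local a b S T x y A B e d : 0 <= S -> 0 <= T ->
  cr_on a b S T -> a <= x <= a + S -> b <= y <= b + T ->
  0 <= e -> S < d -> T < d ->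
  (forall s t, `|s - x| < d -> `|t - y| < d ->
    `|u s t - u x y - (A * (s - x) + - B * (t - y))| <= e * (`|s - x| + `|t - y|)) ->
  (forall s t, `|s - x| < d -> `|t - y| < d ->
    `|v s t - v x y - (B * (s - x) + A * (t - y))| <= e * (`|s - x| + `|t - y|)) ->
  `|circ a b S T| <= 4 * e * (S + T) ^+ 2.
Proof.
move=> S0 T0 h hx hy e0 Sd Td hu hv.
have hs s : a <= s <= a + S -> `|s - x| <= S by move=> ?; rewrite ler_norml; lra.
have ht t : b <= t <= b + T -> `|t - y| <= T by move=> ?; rewrite ler_norml; lra.
have bd (w : R -> R -> R) A' B' :
  (forall s t, `|s - x| < d -> `|t - y| < d ->
    `|w s t - w x y - (A' * (s - x) + B' * (t - y))| <= e * (`|s - x| + `|t - y|)) ->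
  forall s t, a <= s <= a + S -> b <= t <= b + T ->
   `|w s t - w x y - (A' * (s - x) + B' * (t - y))| <= e * (S + T).
  move=> hw s t /hs h1 /ht h2; apply: le_trans (hw _ _ _ _) _; [lra|lra|].
  by apply: ler_wpM2l => //; apply: lerD.
have aS : a <= a + S <= a + S by lra.
have aa : a <= a <= a + S by lra.
have bT : b <= b + T <= b + T by lra.
have bb : b <= b <= b + T by lra.
have cu s1 : a <= s1 <= a + S -> cont_on (u s1) b (b + T) by exact: cr_on_u.
have cv t1 : b <= t1 <= b + T -> cont_on (v ^~ t1) a (a + S) by exact: cr_on_v.
rewrite /circ -!intcB; try by [apply: cu|apply: cv].
have E1 : `|intc (fun t => u (a + S) t - u a t) b (b + T) - (A * S) * (b + T - b)|
   <= (2 * (e * (S + T))) * (b + T - b).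
  apply: intc_near_cst; first by lra.
    move=> t ht'; apply: cvgB; [exact: cu|exact: cu].
  move=> t ht'; have := bd _ _ _ hu _ _ aS ht'; have := bd _ _ _ hu _ _ aa ht'.
  rewrite !ler_norml; set X := e * _; lra.
have E2 : `|intc (fun s => v s (b + T) - v s b) a (a + S) - (A * T) * (a + S - a)|
   <= (2 * (e * (S + T))) * (a + S - a).
  apply: intc_near_cst; first by lra.
    move=> t ht'; apply: cvgB; [exact: (cv (b + T))|exact: (cv b)].
  move=> s hs'; have := bd _ _ _ hv _ _ hs' bT; have := bd _ _ _ hv _ _ hs' bb.
  rewrite !ler_norml; set X := e * _; lra.
move: E1 E2; set I1 := intc _ _ _; set I2 := intc _ _ _ => E1 E2.
have -> : I1 - I2 = (I1 - (A * S) * (b + T - b)) - (I2 - (A * T) * (a + S - a)) by ring.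
apply: le_trans (ler_normB _ _) _; apply: le_trans (lerD E1 E2) _.
have -> : 2 * (e * (S + T)) * (b + T - b) + 2 * (e * (S + T)) * (a + S - a) =
  2 * e * (S + T) ^+ 2 by ring.
have : 0 <= e * (S + T) ^+ 2 by apply: mulr_ge0 => //; exact: sqr_ge0.
lra.
Qed.

Lemma nested_point (a h : nat -> R) :
  (forall k, a k <= a k.+1) -> (forall k, a k.+1 + h k.+1 <= a k + h k) ->
  (forall k, 0 <= h k) -> exists x, forall k, a k <= x <= a k + h k.
Proof.
move=> ha hh h0.
have ma j k : (j <= k)%N -> a j <= a k.
  by move=> /subnK <-; elim: (k - j)%N => // n IH; apply: le_trans IH _; rewrite addSn.
have mb j k : (j <= k)%N -> a k + h k <= a j + h j.
  move=> /subnK <-; elim: (k - j)%N => // n IH; apply: le_trans IH; exact: hh.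
have ub k : ubound (range a) (a k + h k).
  move=> _ [j _ <-]; case: (leqP j k) => jk.
    by apply: le_trans (ma _ _ jk) _; rewrite lerDl.
  by apply: le_trans (mb _ _ (ltnW jk)); rewrite lerDl.
exists (sup (range a)) => k; apply/andP; split.
  by apply: ub_le_sup; [exists (a 0%N + h 0%N); exact: ub|exists k].
by apply: ge_sup => //; exists (a 0%N); exists 0%N.
Qed.

(** Bisection: some quarter always carries at least a quarter of the circulation. At the common
    point of the nested rectangles [circ_local] bounds the k-th circulation by e times the square of
    a length that is 2^k times smaller. This offsets the factor 4^k, so the original circulation is
    O(e) for every e. *)
Theorem goursat a0 b0 S T : 0 <= S -> 0 <= T -> cr_on a0 b0 S T ->
  circ a0 b0 S T = 0.
Proof.
move=> S0 T0 hcr; apply/normr0_eq0/eqP; rewrite eq_le normr_ge0 andbT.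
set I0 := `|circ a0 b0 S T|.
pose hS k := S / 2 ^+ k; pose hT k := T / 2 ^+ k.
have h2 k : 0 < (2 : R) ^+ k by rewrite exprn_gt0.
have hS0 k : 0 <= hS k by apply: divr_ge0 => //; exact: ltW.
have hT0 k : 0 <= hT k by apply: divr_ge0 => //; exact: ltW.
have dS k : hS k = hS k.+1 + hS k.+1.
  by rewrite /hS exprS; field; rewrite gt_eqF.
have dT k : hT k = hT k.+1 + hT k.+1.
  by rewrite /hT exprS; field; rewrite gt_eqF.
pose good k (p : R * R) := [/\ a0 <= p.1, p.1 + hS k <= a0 + S, b0 <= p.2,
  p.2 + hT k <= b0 + T & I0 <= 4 ^+ k * `|circ p.1 p.2 (hS k) (hT k)|].
have good_cr k p : good k p -> cr_on p.1 p.2 (hS k) (hT k).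
  by move=> [h1 h2' h3 h4 _] x y hx hy; apply: hcr; lra.
pose nest k (p q : R * R) := [/\ p.1 <= q.1, q.1 + hS k.+1 <= p.1 + hS k,
  p.2 <= q.2 & q.2 + hT k.+1 <= p.2 + hT k].
(* The hypothesis [good] is placed under the existential so that [choice] gives a total function,
   which is then iterated. *)
have step (kp : nat * (R * R)) : exists q, good kp.1 kp.2 ->
    good kp.1.+1 q /\ nest kp.1 kp.2 q.
  case: kp => k p /=; case: (pselect (good k p)) => [gp|ngp]; last by exists p.
  have := good_cr _ _ gp; case: gp => g1 g2 g3 g4 g5.
  have s0 := hS0 k.+1; have t0 := hT0 k.+1.
  rewrite /nest (dS k) (dT k) in g2 g4 g5 * => cr'.
  have := circ_quarter s0 t0 cr'.
  set s := hS k.+1 in s0 g2 g4 g5 *; set t := hT k.+1 in t0 g2 g4 g5 *.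
  set c1 := circ p.1 p.2 s t; set c2 := circ (p.1 + s) p.2 s t.
  set c3 := circ p.1 (p.2 + t) s t; set c4 := circ (p.1 + s) (p.2 + t) s t => E.
  have q0 : 0 < (4 : R) ^+ k by rewrite exprn_gt0.
  have [|] : (I0 <= 4 ^+ k.+1 * `|c1| \/ I0 <= 4 ^+ k.+1 * `|c2|) \/
             (I0 <= 4 ^+ k.+1 * `|c3| \/ I0 <= 4 ^+ k.+1 * `|c4|).
    rewrite exprS; apply: contrapT.
    move=> /not_orP[/not_orP[/negP + /negP +] /not_orP[/negP + /negP +]].
    rewrite -!ltNge => l1 l2 l3 l4.
    have : 4 ^+ k * `|circ p.1 p.2 (s + s) (t + t)| <=
           4 ^+ k * (`|c1| + `|c2| + `|c3| + `|c4|).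
      rewrite ler_pM2l // E; do 3 (apply: le_trans (ler_normD _ _) _; rewrite lerD2r).
      by [].
    by move: l1 l2 l3 l4 g5; rewrite -!mulrA !mulrDr; set X := 4 ^+ k; lra.
  - move=> [|] h5; [exists (p.1, p.2)|exists (p.1 + s, p.2)] => _;
     (split; first rewrite /good -/s -/t); split => //=; lra.
  - move=> [|] h5; [exists (p.1, p.2 + t)|exists (p.1 + s, p.2 + t)] => _;
     (split; first rewrite /good -/s -/t); split => //=; lra.
have [f hf] := choice step.
pose p := fix p k := if k is k'.+1 then f (k', p k') else (a0, b0).
have gp k : good k (p k).
  elim: k => [|k IH]; last by have [] := hf (k, p k) IH.
  by rewrite /good /hS /hT /= !expr0 !divr1 mul1r; split.
have np k : nest k (p k) (p k.+1) by have [] := hf (k, p k) (gp k).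
have [x hx] : exists x, forall k, (p k).1 <= x <= (p k).1 + hS k.
  by apply: nested_point => // k; have [] := np k.
have [y hy] : exists y, forall k, (p k).2 <= y <= (p k).2 + hT k.
  by apply: nested_point => // k; have [] := np k.
have [A [B [eu ev]]] : cauchy_riemann x y.
  by have := good_cr _ _ (gp 0%N); apply.
have key e : 0 < e -> I0 <= 4 * e * (S + T) ^+ 2.
  move=> e0; have [d1 d10 hd1] := eu e e0; have [d2 d20 hd2] := ev e e0.
  pose d := Num.min d1 d2.
  have d0 : 0 < d by rewrite lt_min d10.
  have [k [Sk Tk]] : exists k, hS k < d /\ hT k < d.
    pose M := S + T + 1.
    have M0 : 0 < M / d by apply: divr_gt0 => //; rewrite /M; lra.
    have := archi_boundP (ltW M0); set k := Num.bound _ => hk.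
    have kk : (k%:R : R) <= 2 ^+ k by rewrite -natrX ler_nat ltnW // ltn_expl.
    have : M < d * 2 ^+ k by rewrite mulrC -ltr_pdivrMr //; exact: lt_le_trans hk kk.
    rewrite /M => hM; exists k; rewrite /hS /hT !ltr_pdivrMr //; split; lra.
  have := @circ_local (p k).1 (p k).2 (hS k) (hT k) x y A B e d (hS0 k) (hT0 k)
    (good_cr _ _ (gp k)) (hx k) (hy k) (ltW e0) Sk Tk.
  move=> hloc; have [_ _ _ _ g5] := gp k.
  apply: le_trans g5 _.
  have E : 4 * e * (S + T) ^+ 2 = 4 ^+ k * (4 * e * (hS k + hT k) ^+ 2).
    rewrite /hS /hT -mulrDl expr_div_n -exprM mulnC exprM (_ : 2 ^+ 2 = 4 :> R);
      last by ring.
    by field; rewrite gt_eqF // exprn_gt0.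
  rewrite E ler_pM2l ?exprn_gt0 //; apply: hloc => // s t hs ht.
    by apply: hd1; [apply: lt_le_trans hs _|apply: lt_le_trans ht _];
      rewrite ge_min lexx.
  by apply: hd2; [apply: lt_le_trans hs _|apply: lt_le_trans ht _];
    rewrite ge_min lexx orbT.
rewrite leNgt; apply/negP => I00.
have ST1 : 0 < (S + T) ^+ 2 + 1 by have := sqr_ge0 (S + T); lra.
(* This e makes the bound at most I0 / 2; the summand 1 keeps the denominator positive when S = T =
   0. *)
have := key (I0 / (8 * ((S + T) ^+ 2 + 1))) _.
rewrite divr_gt0 ?mulr_gt0 // => /(_ isT).
have -> : 4 * (I0 / (8 * ((S + T) ^+ 2 + 1))) * (S + T) ^+ 2 =
   I0 / 2 * ((S + T) ^+ 2 / ((S + T) ^+ 2 + 1)) by field; rewrite gt_eqF.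
have : (S + T) ^+ 2 / ((S + T) ^+ 2 + 1) <= 1 by rewrite ler_pdivrMr // mul1r lerDl.
have : 0 <= (S + T) ^+ 2 / ((S + T) ^+ 2 + 1) by rewrite divr_ge0 ?sqr_ge0 // ltW.
set X := _ / _; nra.
Qed.

End Goursat.

(** * Cauchy's estimate *)

Lemma diff_eps (K : numFieldType) (V W : normedModType K) (f : V -> W) (x : V) :
  differentiable f x -> forall e : K, 0 < e -> exists2 d : K, 0 < d &
  forall h, `|h| < d -> `|f (x + h) - f x - 'd f x h| <= e * `|h|.
Proof.
move=> df e e0; have [_ /eqaddoP/(_ e e0)] := (diff_locallyP x f).1 df.
move=> /nbhs_normP[d /= d0 hd]; exists d => // h hh.
have := hd h; rewrite /ball_ /= sub0r normrN => /(_ hh).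
by rewrite !fctE /= [x + h]addrC opprD addrA.
Qed.

Section ComplexModulus.
Variable R : realType.
Implicit Types z w : cplx R.

(** The norm of [cplx R] takes its values in [cplx R] itself. This is the same modulus as an element
    of R, where order and linear arithmetic are available. *)
Definition cmod z : R := complex.Re `|z|.

Lemma cmodE z : (cmod z)%:C%C = `|z|.
Proof. by apply: RRe_real; exact: normr_real. Qed.

Lemma cmod_ge0 z : 0 <= cmod z.
Proof. by rewrite -ler0c cmodE. Qed.

Lemma lec_cmod z (r : R) : (`|z| <= r%:C%C) = (cmod z <= r).
Proof. by rewrite -cmodE lecR. Qed.

Lemma ltc_cmod z (r : R) : (`|z| < r%:C%C) = (cmod z < r).
Proof. by rewrite -cmodE ltcR. Qed.

Lemma cmodD z w : cmod (z + w) <= cmod z + cmod w.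
Proof. by rewrite -lecR rmorphD /= !cmodE ler_normD. Qed.

Lemma cmodM z w : cmod (z * w) = cmod z * cmod w.
Proof. by apply: complexI; rewrite rmorphM /= !cmodE normrM. Qed.

Lemma cmodN z : cmod (- z) = cmod z.
Proof. by rewrite /cmod normrN. Qed.

Lemma cmod0 : cmod 0 = 0.
Proof. by rewrite /cmod normr0. Qed.

Lemma cmod_real (r : R) : cmod (r%:C%C : cplx R) = `|r|.
Proof.
by rewrite /cmod normc_def /= expr0n /= addr0 sqrtr_sqr.
Qed.

Lemma Re_le_cmod z : `|complex.Re z| <= cmod z.
Proof. by rewrite -lecR cmodE; exact: normc_ge_Re. Qed.

Lemma cmod_i : cmod ('i%C : cplx R) = 1.
Proof. by rewrite /cmod normc_def /= expr0n expr1n add0r sqrtr1. Qed.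

Lemma Im_le_cmod z : `|complex.Im z| <= cmod z.
Proof.
have := Re_le_cmod ((z : cplx R) * ('i%C : cplx R)).
by rewrite cmodM cmod_i mulr1 ReiNIm normrN.
Qed.

Lemma cmod_le_ReIm z : cmod z <= `|complex.Re z| + `|complex.Im z|.
Proof.
rewrite {1}[z](complexE z); apply: le_trans (cmodD _ _) _.
by rewrite cmodM cmod_i mul1r !cmod_real.
Qed.

Lemma cReD z w : complex.Re (z + w) = complex.Re z + complex.Re w.
Proof. by case: z; case: w. Qed.
Lemma cImD z w : complex.Im (z + w) = complex.Im z + complex.Im w.
Proof. by case: z; case: w. Qed.
Lemma cReN z : complex.Re (- z) = - complex.Re z.
Proof. by case: z. Qed.
Lemma cImN z : complex.Im (- z) = - complex.Im z.
Proof. by case: z. Qed.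
Lemma cReM z w : complex.Re (z * w) =
  complex.Re z * complex.Re w - complex.Im z * complex.Im w.
Proof. by case: z; case: w. Qed.
Lemma cImM z w : complex.Im (z * w) =
  complex.Re z * complex.Im w + complex.Im z * complex.Re w.
Proof. by case: z => a b; case: w => c d /=. Qed.

Lemma cdiff_eps (f : cplx R -> cplx R) z : differentiable f z ->
  forall e : R, 0 < e -> exists2 d : R, 0 < d &
  forall w, cmod (w - z) < d ->
   cmod (f w - f z - derive1 f z * (w - z)) <= e * cmod (w - z).
Proof.
move=> df e e0; have ec0 : (0 : cplx R) < (e%:C)%C by rewrite (ltcR 0).
have [d d0 hd] := diff_eps df ec0.
have dE : d = (cmod d)%:C%C by rewrite cmodE gtr0_norm.
exists (cmod d); first by rewrite -ltcR -dE.
move=> w hw; have := hd (w - z); rewrite dE ltc_cmod => /(_ hw).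
rewrite diff1E // (addrC z) subrK -cmodE -(rmorphM (real_complex R)) /= lec_cmod.
by rewrite [_ *: _]mulrC.
Qed.

End ComplexModulus.

(** * Logarithmic polar coordinates *)

Section ExpCoordinates.
Variable R : realType.

Lemma derive_eps (g : R -> R) (x g' : R) : is_derive x (1 : R) g g' ->
  forall e : R, 0 < e -> exists2 d : R, 0 < d &
  forall s, `|s - x| < d -> `|g s - g x - g' * (s - x)| <= e * `|s - x|.
Proof.
move=> dg e e0; have /derivable1_diffP df : derivable g x 1 by case: dg.
have [d d0 hd] := diff_eps df e0; exists d => // s hs.
have := hd _ hs; rewrite diff1E // derive1E derive_val (addrC x) subrK.
by rewrite [_ *: _]mulrC.
Qed.

Lemma expansion_mul (g k : R -> R) (x y g' k' : R) :
  is_derive x (1 : R) g g' -> is_derive y (1 : R) k k' ->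
  expansion (fun s t => g s * k t) x y (g' * k y) (g x * k').
Proof.
move=> dg dk e e0.
(* [M] dominates |k y|, |g x| and the Lipschitz factor |k'| + 1, and [d5] keeps |g s - g x| at most
   [q]. Each of the three error terms is then at most M q times one increment, and e = 2 M q. *)
pose M := `|k y| + `|g x| + `|k'| + 1 + 1.
have [n1 n2 n3] : [/\ 0 <= `|k y|, 0 <= `|g x| & 0 <= `|k'|] by [].
have M0 : 0 < M by rewrite /M; lra.
pose q := e / (M + M); have eM : 0 < q by rewrite divr_gt0 //; lra.
have [d1 d10 h1] := derive_eps dg eM.
have [d2 d20 h2] := derive_eps dk eM.
have [d3 d30 h3] := derive_eps dk ltr01.
have [d4 d40 h4] := derive_eps dg ltr01.
pose d5 := q / (`|g'| + 1).
have ng' : 0 <= `|g'| by [].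
have d50 : 0 < d5 by rewrite divr_gt0 //; lra.
pose d := Num.min (Num.min d1 d2) (Num.min (Num.min d3 d4) d5).
exists d; first by rewrite !lt_min d10 d20 d30 d40 d50.
move=> s t; rewrite !lt_min => /andP[/andP[s1 s2] /andP[/andP[s3 s4] s5]].
move=> /andP[/andP[t1 t2] /andP[/andP[t3 t4] t5]].
have -> : g s * k t - g x * k y - (g' * k y * (s - x) + g x * k' * (t - y)) =
  k y * (g s - g x - g' * (s - x)) + g x * (k t - k y - k' * (t - y))
  + (g s - g x) * (k t - k y) by ring.
have {}h1 := h1 _ s1; have {}h2 := h2 _ t2; have {}h3 := h3 _ t3; have {}h4 := h4 _ s4.
have b1 : `|g s - g x| <= (`|g'| + 1) * `|s - x|.
  rewrite -[X in `|X|](subrK (g' * (s - x))) mulrDl mul1r addrC.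
  apply: le_trans (ler_normD _ _) _; rewrite normrM lerD2l.
  by rewrite mul1r in h4.
have b2 : `|k t - k y| <= M * `|t - y|.
  rewrite -[X in `|X|](subrK (k' * (t - y))).
  apply: le_trans (ler_normD _ _) _; rewrite normrM.
  apply: le_trans (_ : (1 + `|k'|) * `|t - y| <= _); first by rewrite mulrDl lerD2r.
  by apply: ler_wpM2r => //; rewrite /M; lra.
apply: le_trans (ler_normD _ _) _; apply: le_trans (lerD (ler_normD _ _) (lexx _)) _.
rewrite !normrM.
have qe : e = q * (M + M) by rewrite /q divfK //; apply: lt0r_neq0; lra.
have s5' : (`|g'| + 1) * `|s - x| <= q.
  by rewrite mulrC -ler_pdivlMr ?ltW //; lra.
have e1 : `|k y| * `|g s - g x - g' * (s - x)| <= M * (q * `|s - x|).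
  by apply: ler_pM => //; rewrite /M; lra.
have e2 : `|g x| * `|k t - k y - k' * (t - y)| <= M * (q * `|t - y|).
  by apply: ler_pM => //; rewrite /M; lra.
have e3 : `|g s - g x| * `|k t - k y| <= q * (M * `|t - y|).
  by apply: ler_pM => //; exact: le_trans b1 s5'.
rewrite qe; have : 0 <= q * M * `|s - x| by rewrite mulr_ge0 // mulr_ge0 // ltW.
move: e1 e2 e3; set X := `|s - x|; set Y := `|t - y|; lra.
Qed.

(** The exponential of s + i t. It wraps a rectangle of height 2 pi onto an annulus, so that
    Goursat's theorem on rectangles compares integrals over concentric circles. *)
Definition cexp (s t : R) : cplx R := (expR s * cos t +i* (expR s * sin t))%C.

(** Complex differentiability of w in the variable s + i t, with derivative c, in the same l^1 form
    as [expansion]. *)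
Definition cexpansion (w : R -> R -> cplx R) (x y : R) (c : cplx R) :=
  forall e : R, 0 < e -> exists2 d : R, 0 < d & forall s t,
    `|s - x| < d -> `|t - y| < d ->
    cmod (w s t - w x y - c * ((s - x) +i* (t - y))%C) <= e * (`|s - x| + `|t - y|).

Lemma cexpansion_cexp x y : cexpansion cexp x y (cexp x y).
Proof.
move=> e e0; have e20 : 0 < e / 2 by lra.
have hre := @expansion_mul expR cos x y _ _ (is_derive_expR x) (is_derive_cos y).
have him := @expansion_mul expR sin x y _ _ (is_derive_expR x) (is_derive_sin y).
have [d1 d10 h1] := hre _ e20.
have [d2 d20 h2] := him _ e20.
exists (Num.min d1 d2); first by rewrite lt_min d10.
move=> s t; rewrite !lt_min => /andP[s1 s2] /andP[t1 t2].
apply: le_trans (cmod_le_ReIm _) _.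
have {}h1 := h1 _ _ s1 t1; have {}h2 := h2 _ _ s2 t2.
have -> : e * (`|s - x| + `|t - y|) =
    e / 2 * (`|s - x| + `|t - y|) + e / 2 * (`|s - x| + `|t - y|)
  by field.
apply: lerD.
  apply: le_trans h1; rewrite le_eqVlt; apply/orP; left; apply/eqP; congr `|_|.
  by rewrite /cexp !(cReD, cReN, cReM) /=; ring.
apply: le_trans h2; rewrite le_eqVlt; apply/orP; left; apply/eqP; congr `|_|.
by rewrite /cexp !(cImD, cImN, cImM) /=; ring.
Qed.

Lemma cmod_pair (a b : R) : cmod ((a +i* b)%C : cplx R) <= `|a| + `|b|.
Proof. exact: cmod_le_ReIm. Qed.

Lemma cexpansion_comp (f : cplx R -> cplx R) w x y c :
  differentiable f (w x y) -> cexpansion w x y c ->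
  cexpansion (fun s t => f (w s t)) x y (derive1 f (w x y) * c).
Proof.
move=> df hw e e0; set D := derive1 f _.
have c0 := cmod_ge0 c; have D0 := cmod_ge0 D.
pose q := e / (cmod D + cmod c + 1).
have q0 : 0 < q by rewrite divr_gt0 //; lra.
have [d1 d10 h1] := cdiff_eps df q0.
have [d2 d20 h2] := hw _ q0.
have [d3 d30 h3] := hw _ ltr01.
pose M := cmod c + 1; have M0 : 0 < M by rewrite /M; lra.
pose d4 := d1 / (M + M).
have d40 : 0 < d4 by rewrite divr_gt0 //; lra.
exists (Num.min (Num.min d2 d3) d4); first by rewrite !lt_min d20 d30 d40.
move=> s t; rewrite !lt_min => /andP[/andP[s2 s3] s4] /andP[/andP[t2 t3] t4].
have {}h2 := h2 _ _ s2 t2; have {}h3 := h3 _ _ s3 t3.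
set h := ((s - x) +i* (t - y))%C in h2 h3 *.
have hb : cmod h <= `|s - x| + `|t - y| by exact: cmod_pair.
have bw : cmod (w s t - w x y) <= M * (`|s - x| + `|t - y|).
  rewrite -[X in cmod X](subrK (c * h)); apply: le_trans (cmodD _ _) _.
  rewrite /M mulrDl addrC; apply: lerD => //.
  by rewrite cmodM; exact: ler_wpM2l.
have {}h1 := h1 (w s t); have : cmod (w s t - w x y) < d1.
  apply: le_lt_trans bw _; rewrite mulrC -ltr_pdivlMr //.
  have MM : M + M = M * 2 by ring.
  have -> : d1 / M = d4 + d4 by rewrite /d4 MM; field; exact: lt0r_neq0.
  exact: ltrD.
move=> /h1 {}h1.
have -> : f (w s t) - f (w x y) - D * c * h =
  (f (w s t) - f (w x y) - D * (w s t - w x y)) + D * (w s t - w x y - c * h) by ring.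
apply: le_trans (cmodD _ _) _; rewrite cmodM.
have e1 : q * cmod (w s t - w x y) <= q * (M * (`|s - x| + `|t - y|)).
  by apply: ler_wpM2l => //; exact: ltW.
have e2 : cmod D * cmod (w s t - w x y - c * h) <= cmod D * (q * (`|s - x| + `|t - y|)).
  exact: ler_wpM2l.
have -> : e = q * (cmod D + cmod c + 1) by rewrite /q divfK //; apply: lt0r_neq0; lra.
apply: le_trans (lerD (le_trans h1 e1) e2) _.
by rewrite /M le_eqVlt; apply/orP; left; apply/eqP; ring.
Qed.

Lemma cexpansion_cr w x y c : cexpansion w x y c ->
  cauchy_riemann (fun s t => complex.Re (w s t)) (fun s t => complex.Im (w s t)) x y.
Proof.
move=> h; exists (complex.Re c), (complex.Im c); split=> e e0;
  have [d d0 hd] := h e e0; exists d => // s t hs ht;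
  have := hd s t hs ht; apply: le_trans.
  apply: le_trans (Re_le_cmod _); rewrite le_eqVlt; apply/orP; left; apply/eqP.
  by congr `|_|; rewrite !(cReD, cReN, cReM) /=; ring.
apply: le_trans (Im_le_cmod _); rewrite le_eqVlt; apply/orP; left; apply/eqP.
by congr `|_|; rewrite !(cImD, cImN, cImM) /=; ring.
Qed.

Lemma cexp_neq0 s t : cexp s t != 0.
Proof.
apply/eqP => -[/eqP + /eqP]; rewrite !mulf_eq0 !(gt_eqF (expR_gt0 _)) /= => /eqP c0 /eqP s0.
by have := cos2Dsin2 t; rewrite c0 s0 expr0n /= addr0 => /esym/eqP; rewrite oner_eq0.
Qed.

Lemma cmod_cexp s t : cmod (cexp s t) = expR s.
Proof.
rewrite /cmod normc_def /=.
have -> : (expR s * cos t) ^+ 2 + (expR s * sin t) ^+ 2 = expR s ^+ 2 :> R.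
  by rewrite !exprMn -mulrDr cos2Dsin2 mulr1.
by rewrite sqrtr_sqr gtr0_norm // expR_gt0.
Qed.

End ExpCoordinates.

Section OddPart.
Variables (K : numFieldType) (f : K -> K).

(** The odd part vanishes at 0, has the same derivative there as f, and is bounded by any bound of
    f. It reduces Cauchy's estimate to maps fixing 0 without composing with an automorphism of the
    disc. *)
Lemma is_diff_oddpart z : differentiable f z -> differentiable f (- z) ->
  is_diff z (fun w => 2^-1 * (f w - f (- w)))
    (2^-1 *: (('d f z : K -> K) - ('d f (- z) \o -%R : K -> K))).
Proof.
move=> hf hfN; have h1 : is_diff z f ('d f z) by exact: differentiableP.
have h2 : is_diff (- z) f ('d f (- z)) by exact: differentiableP.
have h3 : is_diff z (-%R : K -> K) (-%R).
  have -> : (-%R : K -> K) = - id by [].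
  exact: is_diffN.
have h4 : is_diff z (f \o -%R) ('d f (- z) \o -%R) by exact: is_diff_comp.
exact: is_diffZ.
Qed.

Lemma differentiable_oddpart z : differentiable f z -> differentiable f (- z) ->
  differentiable (fun w => 2^-1 * (f w - f (- w))) z.
Proof. by move=> h1 h2; have [] := is_diff_oddpart h1 h2. Qed.

Lemma derive1_oddpart : differentiable f 0 ->
  derive1 (fun w => 2^-1 * (f w - f (- w))) 0 = derive1 f 0.
Proof.
move=> hf; have hfN : differentiable f (- 0) by rewrite oppr0.
have [dF E] := is_diff_oddpart hf hfN.
rewrite (derive1E' dF) (derive1E' hf) E.
transitivity (2^-1 * ('d f 0 1 - 'd f (- 0) (- 1))); first by [].
have N0 : - 0 = 0 :> K by exact: oppr0.
have hN : 'd f 0 (- 1) = - 'd f 0 1 by exact: raddfN.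
rewrite N0 hN.
move: ('d f 0 1 : K) => d.
by rewrite opprK -mulr2n -(mulr_natl d 2) mulrA mulVf ?mul1r // pnatr_eq0.
Qed.

End OddPart.

Section CauchyEstimate.
Variable R : realType.

Lemma cexp_periodic (s : R) : cexp s (0 + (pi + pi)) = cexp s 0.
Proof. by rewrite /cexp -mulr2n cosD2pi sinD2pi. Qed.

Lemma unit_discE (z : cplx R) : unit_disc z <-> cmod z < 1.
Proof. by rewrite /unit_disc /= -ltc_cmod. Qed.

(** In the coordinates [cexp] the vertical edges give the two circle integrals, and the horizontal
    edges, at heights 0 and 2 pi, cancel by periodicity. A singularity at 0 is harmless since [cexp]
    never vanishes. *)
Lemma holomorphic_mean (psi : cplx R -> cplx R) (s1 s2 : R) :
  (forall z, z != 0 -> unit_disc z -> differentiable psi z) ->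
  s1 <= s2 -> s2 < 0 ->
  intc (fun t => complex.Re (psi (cexp s2 t))) 0 (0 + (pi + pi)) =
  intc (fun t => complex.Re (psi (cexp s1 t))) 0 (0 + (pi + pi)).
Proof.
move=> dpsi s12 s20; have pi0 := pi_ge0 R.
set u := fun s t => complex.Re (psi (cexp s t)).
pose v := fun s t => complex.Im (psi (cexp s t)).
have cr : cr_on u v s1 0 (s2 - s1) (pi + pi).
  move=> s t hs _; apply: cexpansion_cr; apply: cexpansion_comp.
    apply: dpsi; first exact: cexp_neq0.
    by rewrite unit_discE cmod_cexp -expR0 ltr_expR; lra.
  exact: cexpansion_cexp.
have := goursat _ _ cr; rewrite /circ.
have -> : v^~ (0 + (pi + pi)) = v^~ 0.
  by apply/funext => s; rewrite /v cexp_periodic.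
rewrite subrr subr0 [s1 + _]addrC subrK => h.
by apply/subr0_eq/h; lra.
Qed.

Lemma mean_contradiction (r p I : R) : 1 < r -> 0 < p ->
  - ((r - 1) / 2 * p) <= I - r * p -> I - 0 * p <= (1 + (r - 1) / 4) * p -> False.
Proof.
move=> r1 p0; have : 0 < (r - 1) * p by apply: mulr_gt0 => //; lra.
lra.
Qed.

(** Suppose r = |F'(0)| > 1, and rotate F by the unimodular k with k F'(0) = r. On small circles k
    F(z) / z is close to r, while on the circle of radius 1 / q its modulus is at most q. The means
    of its real part on the two circles agree, which is absurd when q is close to 1. *)
Lemma cauchy_estimate0 (F : cplx R -> cplx R) : holomorphic (@unit_disc R) F ->
  (forall z, unit_disc z -> cmod (F z) <= 1) -> F 0 = 0 ->
  cmod (derive1 F 0) <= 1.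
Proof.
move=> hF bF F0; rewrite leNgt; apply/negP; set c := derive1 F 0 => c1.
pose r := cmod c; have r1 : 1 < r by [].
have cn0 : `|c| != 0.
  by rewrite normr_eq0; apply/eqP => c0; move: c1; rewrite c0 cmod0; lra.
pose k : cplx R := c^* / `|c|.
have kc : k * c = (r%:C)%C.
  by rewrite /k mulrAC [_ * c]mulrC -normCK cmodE expr2 mulfK.
have k1 : cmod k = 1.
  apply: complexI; rewrite cmodE rmorph1 /k normrM normfV norm_conjC normr_id.
  by rewrite divff.
pose psi z := k * (F z / z).
have dpsi z : z != 0 -> unit_disc z -> differentiable psi z.
  move=> z0 hz; apply: differentiableM => //; apply: differentiableM; first exact: hF.
  exact: differentiableV.
have d0 : unit_disc (0 : cplx R) by rewrite /unit_disc /= normr0 ltr01.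
(* With [q] = 1 + (r - 1) / 4 as below, r - eta = 1 + (r - 1) / 2 exceeds [q]: the two estimates of
   the mean are incompatible. *)
pose eta := (r - 1) / 2; have eta0 : 0 < eta by rewrite /eta; lra.
have [d dp hd] := cdiff_eps (hF 0 d0) eta0.
pose q := 1 + (r - 1) / 4; have q1 : 1 < q by rewrite /q; lra.
pose s2 := - ln q; have s20 : s2 < 0 by rewrite oppr_lt0 ln_gt0.
(* Circles are indexed by the logarithm of their radius: exp s2 = 1 / q < 1, while exp s1 is below
   both exp s2 and the radius [d] of validity of the expansion at 0. *)
pose s1 := Num.min s2 (ln d) - 1.
have [s12 s1d] : s1 < s2 /\ s1 < ln d.
  have m1 : Num.min s2 (ln d) <= s2 by rewrite ge_min lexx.
  have m2 : Num.min s2 (ln d) <= ln d by rewrite ge_min lexx orbT.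
  by rewrite /s1; split; lra.
have pi0 := pi_gt0 R.
have := holomorphic_mean dpsi (ltW s12) s20.
have cont s : s < 0 -> cont_on (fun t => complex.Re (psi (cexp s t))) 0 (0 + (pi + pi)).
  move=> s0 t _.
  have : cexpansion (fun s t => psi (cexp s t)) s t (derive1 psi (cexp s t) * cexp s t).
    apply: cexpansion_comp; last exact: cexpansion_cexp.
    apply: dpsi; first exact: cexp_neq0.
    by rewrite unit_discE cmod_cexp -expR0 ltr_expR.
  by move=> /cexpansion_cr [A [B [/expansion_cont2]]].
have cmodF z : z != 0 -> cmod (psi z) = cmod (F z) / cmod z.
  move=> z0; rewrite /psi cmodM k1 mul1r; apply: complexI.
  by rewrite rmorphM fmorphV /= !cmodE normrM normfV.
have b2 : `|intc (fun t => complex.Re (psi (cexp s2 t))) 0 (0 + (pi + pi)) -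
    0 * (0 + (pi + pi) - 0)| <= q * (0 + (pi + pi) - 0).
  apply: intc_near_cst; [lra|exact: cont|] => t _; rewrite subr0.
  apply: le_trans (Re_le_cmod _) _; rewrite cmodF ?cexp_neq0 // cmod_cexp.
  rewrite ler_pdivrMr ?expR_gt0 // /s2 expRN lnK ?posrE ?divff //; last by lra.
    by apply: bF; rewrite unit_discE cmod_cexp -expR0 ltr_expR.
  by apply: lt0r_neq0; lra.
have b1 : `|intc (fun t => complex.Re (psi (cexp s1 t))) 0 (0 + (pi + pi)) -
    r * (0 + (pi + pi) - 0)| <= eta * (0 + (pi + pi) - 0).
  apply: intc_near_cst; [lra|by apply: cont; lra|] => t _.
  set z := cexp s1 t; have z0 : z != 0 by exact: cexp_neq0.
  have -> : complex.Re (psi z) - r = complex.Re (psi z - (r%:C)%C).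
    by rewrite cReD cReN.
  apply: le_trans (Re_le_cmod _) _.
  have -> : psi z - (r%:C)%C = k * ((F z - F 0 - c * (z - 0)) / z).
    by rewrite -kc F0 /psi !subr0; field.
  rewrite cmodM k1 mul1r.
  have -> : cmod ((F z - F 0 - c * (z - 0)) / z) = cmod (F z - F 0 - c * (z - 0)) / cmod z.
    by apply: complexI; rewrite rmorphM fmorphV /= !cmodE normrM normfV.
  have zE : cmod z = expR s1 by exact: cmod_cexp.
  rewrite ler_pdivrMr ?zE ?expR_gt0 // -zE; have := hd z; rewrite !subr0; apply.
  by rewrite zE -[d]lnK ?posrE // ltr_expR.
move=> E; rewrite E in b2; move: b1 b2; set I := intc _ _ _.
have p0 : 0 < 0 + (pi + pi) - 0 :> R by rewrite add0r subr0 addr_gt0.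
rewrite !ler_norml => /andP[h1 _] /andP[_ h2].
exact: (mean_contradiction r1 p0 h1 h2).
Qed.

Lemma cauchy_estimate (f : cplx R -> cplx R) : holomorphic (@unit_disc R) f ->
  f @` (@unit_disc R) `<=` @unit_disc R -> cmod (derive1 f 0) <= 1.
Proof.
move=> hf fD.
have d0 : unit_disc (0 : cplx R) by rewrite /unit_disc /= normr0 ltr01.
have dN z : unit_disc z -> unit_disc (- z : cplx R) by rewrite /unit_disc /= normrN.
pose F z : cplx R := 2^-1 * (f z - f (- z)).
have E : derive1 F 0 = derive1 f 0 by apply: derive1_oddpart; exact: hf.
rewrite -E; apply: cauchy_estimate0.
- by move=> z hz; apply: differentiable_oddpart; apply: hf => //; exact: dN.
- move=> z hz; rewrite -lec_cmod /F normrM normfV normr_nat.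
  rewrite ler_pdivrMl ?ltr0n // mulr1; apply: le_trans (ler_normB _ _) _.
  have h1 : unit_disc (f z) by apply: fD; exists z.
  have h2 : unit_disc (f (- z)) by apply: fD; exists (- z) => //; exact: dN.
  by rewrite [leRHS](_ : _ = 1 + 1) //; apply: lerD; apply: ltW.
- by rewrite /F oppr0 subrr mulr0.
Qed.

End CauchyEstimate.

(** * Comparison with discs and bounded functions *)

Lemma derive1_comp_diff (K : numFieldType) (V W : normedModType K) (f : K -> V)
  (h : V -> W) x : differentiable f x -> differentiable h (f x) ->
  derive1 (h \o f) x = 'd h (f x) (derive1 f x).
Proof.
move=> df dh; have dhf : differentiable (h \o f) x by exact: differentiable_comp.
by rewrite (derive1E' dhf) (derive1E' df) diff_comp.
Qed.

Section Sandwich.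
Variable R : realType.

Definition is_disc n (D : set 'rV[cplx R]_n) z xi (a : R)
    (f : cplx R -> 'rV[cplx R]_n) :=
  [/\ holomorphic (@unit_disc R) f, f @` @unit_disc R `<=` D, f 0 = z
    & derive1 f 0 = (a%:C%C : cplx R) *: xi].

Definition is_bounded_fun n (D : set 'rV[cplx R]_n) (h : 'rV[cplx R]_n -> cplx R) :=
  holomorphic D h /\ h @` D `<=` @unit_disc R.

Lemma disc0 : @unit_disc R 0.
Proof. by rewrite /unit_disc /= normr0 ltr01. Qed.

(** The composite h o f maps the unit disc to itself and has derivative a dh(z) xi at 0, to which
    Cauchy's estimate applies. *)
Lemma schwarz_pair n (D : set 'rV[cplx R]_n) z xi a f h : 0 < a ->
  is_disc D z xi a f -> is_bounded_fun D h -> cmod ('d h z xi) <= a^-1.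
Proof.
move=> a0 [hf fD f0 df] [hh hD].
have hfD w : unit_disc w -> D (f w) by move=> hw; apply: fD; exists w.
have E : derive1 (h \o f) 0 = (a%:C)%C * 'd h z xi.
  rewrite (derive1_comp_diff (hf 0 disc0) (hh _ (hfD 0 disc0))).
  by rewrite f0 df linearZ.
have := @cauchy_estimate R (h \o f); rewrite E cmodM cmod_real gtr0_norm //.
rewrite -ler_pdivlMl // mulr1; apply.
- move=> w hw; apply: differentiable_comp; first exact: hf.
  exact/hh/hfD.
- by move=> _ [w hw <-]; apply: hD; exists (f w) => //; exact: hfD.
Qed.

(** All that the rest of the proof uses about the two metrics. The second bound also asks for a
    disc: it makes the set defining the Kobayashi infimum nonempty and the one defining the
    Carathéodory supremum bounded, so that neither takes a default value. *)
Definition sandwiched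
    (F : forall n, set 'rV[cplx R]_n -> 'rV[cplx R]_n -> 'rV[cplx R]_n -> R) :=
  (forall n D z xi a f, 0 < a -> @is_disc n D z xi a f -> F n D z xi <= a^-1) /\
  (forall n D z xi a f h, 0 < a -> @is_disc n D z xi a f -> is_bounded_fun D h ->
    cmod ('d h z xi) <= F n D z xi).

Lemma kobayashi_sandwiched : sandwiched (@kobayashi R).
Proof.
split=> n D z xi a f.
  move=> a0 hf; apply: ge_inf; last by exists a; split => //; exists f.
  by exists 0 => _ [b [b0 -> _]]; rewrite invr_ge0 ltW.
move=> h a0 hf hh; apply: lb_le_inf; first by exists a^-1, a; split=> //; exists f.
by move=> _ [b [b0 -> [g hg]]]; exact: schwarz_pair b0 hg hh.
Qed.

Lemma caratheodory_sandwiched : sandwiched (@caratheodory R).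
Proof.
have bd n D z xi a f : 0 < a -> @is_disc n D z xi a f ->
    ubound [set r | exists f : 'rV[cplx R]_n -> cplx R,
    [/\ holomorphic D f, f @` D `<=` @unit_disc R
      & ((r%:C)%C : cplx R) = `|'d f z xi|]] a^-1.
  move=> a0 hf r [h [h1 h2 h3]].
  have := schwarz_pair a0 hf (conj h1 h2).
  by apply: le_trans; rewrite -lecR h3 cmodE.
split=> n D z xi a f.
  move=> a0 hf; apply: ge_sup; last exact: bd a0 hf.
  exists 0, (cst 0); split.
  - by move=> w _; exact: differentiable_cst.
  - by move=> _ [w _ <-]; exact: disc0.
  - by rewrite diff_cst /= normr0.
move=> h a0 hf [h1 h2]; apply: ub_le_sup; first by exists a^-1; exact: bd a0 hf.
by exists h; split => //; rewrite cmodE.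
Qed.

End Sandwich.

(** * The metrics of the ball *)

Section Hermitian.
Variables (C : numClosedFieldType) (n : nat).
Implicit Types (u v w x : 'rV[C]_n) (c : C).

Definition hdot u v : C := \sum_j u 0 j * (v 0 j)^*.

Lemma hdotDl u v w : hdot (u + v) w = hdot u w + hdot v w.
Proof. by rewrite -big_split; apply: eq_bigr => j _; rewrite mxE mulrDl. Qed.

Lemma hdotZl c u w : hdot (c *: u) w = c * hdot u w.
Proof. by rewrite mulr_sumr; apply: eq_bigr => j _; rewrite mxE mulrA. Qed.

Lemma hdotC u v : hdot u v = (hdot v u)^*.
Proof.
by rewrite rmorph_sum; apply: eq_bigr => j _; rewrite rmorphM /= conjCK mulrC.
Qed.

Lemma hdotNl u w : hdot (- u) w = - hdot u w.
Proof. by rewrite -scaleN1r hdotZl mulN1r. Qed.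

Lemma hdotDr u v w : hdot w (u + v) = hdot w u + hdot w v.
Proof. by rewrite hdotC hdotDl rmorphD /= -!hdotC. Qed.

Lemma hdotZr c u w : hdot w (c *: u) = c^* * hdot w u.
Proof. by rewrite hdotC hdotZl rmorphM /= -hdotC. Qed.

Lemma hdotNr u w : hdot w (- u) = - hdot w u.
Proof. by rewrite hdotC hdotNl rmorphN /= -hdotC. Qed.

Definition hdotE := (hdotDl, hdotZl, hdotNl, hdotDr, hdotZr, hdotNr).

Lemma hsqE u : hdot u u = \sum_j `|u 0 j| ^+ 2.
Proof. by apply: eq_bigr => j _; rewrite normCK. Qed.

Lemma hsq_ge0 u : 0 <= hdot u u.
Proof. by rewrite hsqE; apply: sumr_ge0 => j _; rewrite exprn_ge0. Qed.

Lemma hsq_eq0 u : hdot u u = 0 -> u = 0.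
Proof.
rewrite hsqE => /eqP; rewrite psumr_eq0 => [/allP h|j _]; last by rewrite exprn_ge0.
apply/rowP => j; rewrite mxE; apply/eqP; rewrite -normr_eq0 -sqrf_eq0.
exact: h (mem_index_enum _).
Qed.

(** The difference of the two sides is the squared norm of the component of x orthogonal to u. *)
Lemma hdot_unit_le x u : hdot u u = 1 -> `|hdot x u| ^+ 2 <= hdot x x.
Proof.
move=> u1; rewrite -subr_ge0; apply: le_trans (hsq_ge0 (x - hdot x u *: u)) _.
rewrite !hdotE u1 [hdot u x]hdotC normCK.
by rewrite le_eqVlt; apply/orP; left; apply/eqP; ring.
Qed.

Lemma parallelogram u v :
  hdot (u + v) (u + v) + hdot (u - v) (u - v) = 2 * hdot u u + 2 * hdot v v.
Proof. by rewrite !hdotE; ring. Qed.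

Lemma differentiable_hdot v x : differentiable (hdot ^~ v) x.
Proof.
have -> : hdot ^~ v = \sum_(j < n) (fun u : 'rV[C]_n => u 0 j * (v 0 j)^*).
  by apply/funext => u; rewrite fct_sumE.
apply: differentiable_sum => j; apply: differentiableM; first exact: differentiable_coord.
exact: differentiable_cst.
Qed.

End Hermitian.

(** * Involutive automorphisms of the ball *)

Section BallAutomorphism.
Variables (C : numClosedFieldType) (n : nat) (a : 'rV[C]_n) (s : C).
Hypotheses (s_gt0 : 0 < s) (hs : hdot a a = 1 - s ^+ 2).
Implicit Types (w x : 'rV[C]_n).

Let s1 : 1 + s != 0.
Proof. by rewrite lt0r_neq0 // addr_gt0. Qed.

Let sJ : s^* = s.
Proof. by apply/CrealP; rewrite gtr0_real. Qed.

(* The involution exchanging 0 and [a] is [w |-> (a - L w) / (1 - <w, a>)]. *)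
Definition ball_lin w := s *: w + (hdot w a / (1 + s)) *: a.

Lemma ball_linD w x : ball_lin (w + x) = ball_lin w + ball_lin x.
Proof. by rewrite /ball_lin hdotDl mulrDl scalerDl scalerDr addrACA. Qed.

Lemma ball_linZ c w : ball_lin (c *: w) = c *: ball_lin w.
Proof. by rewrite /ball_lin hdotZl scalerDr !scalerA mulrA [s * c]mulrC. Qed.

Lemma ball_linN w : ball_lin (- w) = - ball_lin w.
Proof. by rewrite -scaleN1r ball_linZ scaleN1r. Qed.

(** The component along [a] is kept because s + (1 - s^2) / (1 + s) = 1. *)
Lemma hdot_ball_lin w : hdot (ball_lin w) a = hdot w a.
Proof. by rewrite /ball_lin !hdotE hs; field. Qed.

Lemma ball_lin2 w : ball_lin (ball_lin w) = s ^+ 2 *: w + hdot w a *: a.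
Proof.
rewrite {1}/ball_lin hdot_ball_lin /ball_lin scalerDr !scalerA -addrA -scalerDl.
by congr (_ *: _ + _ *: _); field.
Qed.

Lemma ball_lin_center : ball_lin a = a.
Proof.
by rewrite /ball_lin hs -scalerDl -[RHS]scale1r; congr (_ *: _); field.
Qed.

Lemma hsq_ball_lin w :
  hdot (ball_lin w) (ball_lin w) = s ^+ 2 * hdot w w + `|hdot w a| ^+ 2.
Proof.
rewrite {1}/ball_lin hdotDl !hdotZl [hdot a _]hdotC hdot_ball_lin.
have -> : hdot w (ball_lin w) = s * hdot w w + (hdot w a)^* / (1 + s) * hdot w a.
  rewrite /ball_lin !hdotE sJ; congr (_ + _ * _).
  by rewrite rmorphM fmorphV rmorphD rmorph1 /= sJ.
by rewrite normCK; field.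
Qed.

Lemma ball_lin_parallelogram w x (k : C) :
  hdot (ball_lin (w + x)) (ball_lin (w + x)) / k +
  hdot (ball_lin (w - x)) (ball_lin (w - x)) / k =
  hdot (ball_lin w) (ball_lin w) / k + hdot (ball_lin w) (ball_lin w) / k +
  (hdot (ball_lin x) (ball_lin x) / k + hdot (ball_lin x) (ball_lin x) / k).
Proof.
by rewrite -!mulrDl 2!ball_linD ball_linN parallelogram !mulr_natl !mulr2n.
Qed.

(** The identity 1 - |phi(w)|^2 = s^2 (1 - |w|^2) / |1 - <w, a>|^2 for the involution phi, with the
    denominator cleared. It yields both facts below: at a zero of the denominator the left side
    would be negative, and elsewhere phi(w) stays in the ball. *)
Lemma hsq_numerator w : hdot (a - ball_lin w) (a - ball_lin w) =
  `|1 - hdot w a| ^+ 2 - s ^+ 2 * (1 - hdot w w).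
Proof.
rewrite !hdotDl !hdotNl !hdotDr !hdotNr hsq_ball_lin hdot_ball_lin.
rewrite [hdot a (ball_lin w)]hdotC hdot_ball_lin hs !normCK rmorphB rmorph1 /=.
by ring.
Qed.

Lemma denominator_neq0 w : hdot w w < 1 -> 1 - hdot w a != 0.
Proof.
move=> w1; apply/eqP => h; have := hsq_ge0 (a - ball_lin w).
rewrite hsq_numerator h normr0 expr0n /= sub0r oppr_ge0 => /le_lt_trans.
have : 0 < s ^+ 2 * (1 - hdot w w) by rewrite mulr_gt0 ?exprn_gt0 // subr_gt0.
by move=> h1 /(_ _ h1); rewrite ltxx.
Qed.

Lemma ball_involution_lt1 w : hdot w w < 1 ->
  hdot ((1 - hdot w a)^-1 *: (a - ball_lin w)) ((1 - hdot w a)^-1 *: (a - ball_lin w)) < 1.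
Proof.
move=> w1; have d0 := denominator_neq0 w1.
rewrite hdotZl hdotZr mulrA -normCK normfV hsq_numerator mulrBr -exprMn.
rewrite mulVf ?normr_eq0 // expr1n ltrBlDr ltrDl.
by rewrite !mulr_gt0 ?exprn_gt0 ?invr_gt0 ?normr_gt0 // subr_gt0.
Qed.

End BallAutomorphism.

(** * Linear fractional functions of one variable *)

Section LinearFractional.
Variable K : numFieldType.

(* Every disc and test function is, along the relevant line, affine in some
   [linfrac q], so that this is the only derivative to compute. *)
Definition linfrac (q t : K) : K := t / (1 + q * t).

Lemma linfrac0 q : linfrac q 0 = 0.
Proof. by rewrite /linfrac mul0r. Qed.

Lemma is_diff_linfrac_den (q t : K) : is_diff t (fun t : K => 1 + q * t) ( *:%R q).
Proof.
have h : is_diff t (cst 1 + *:%R q : K -> K) (0 + *:%R q).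
  by apply: is_diffD.
by rewrite add0r in h.
Qed.

Lemma differentiable_linfrac (q t : K) : 1 + q * t != 0 ->
  differentiable (linfrac q) t.
Proof.
move=> h; apply: differentiableM; first by have [] := is_diff_id t.
by apply: differentiableV => //; have [] := is_diff_linfrac_den q t.
Qed.

Lemma derive1_linfrac0 (q : K) : derive1 (linfrac q) 0 = 1.
Proof.
have h : 1 + q * 0 != 0 by rewrite mulr0 addr0 oner_neq0.
have dd : differentiable (fun t : K => 1 + q * t) 0.
  by have [] := is_diff_linfrac_den q 0.
have dV : differentiable (fun t : K => (1 + q * t)^-1) 0 by exact: differentiableV.
have di : differentiable (id : K -> K) 0 by have [] := is_diff_id (0 : K).
rewrite derive1E' //; last exact: differentiable_linfrac.
rewrite -[linfrac q]/(id * (fun t : K => (1 + q * t)^-1)) diffM //.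
have -> : 'd (id : K -> K) 0 = id :> (_ -> _) by have [] := is_diff_id (0 : K).
transitivity (0 * 'd (fun t : K => (1 + q * t)^-1) 0 1 + (1 + q * 0)^-1 * 1); first by [].
by rewrite mul0r add0r mulr0 addr0 invr1 mulr1.
Qed.

Variable V : normedModType K.

Lemma differentiable_linfracZ (b v w : V) q r t : 1 + q * t != 0 -> 1 + r * t != 0 ->
  differentiable (fun t => b + linfrac q t *: v + linfrac r t *: w) t.
Proof.
move=> hq hr; apply: differentiableD; [apply: differentiableD|].
- exact: differentiable_cst.
- exact/differentiableZl/differentiable_linfrac.
- exact/differentiableZl/differentiable_linfrac.
Qed.

Lemma derive1_linfracZ (b v w : V) q r :
  derive1 (fun t => b + linfrac q t *: v + linfrac r t *: w) 0 = v + w.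
Proof.
have h0 (x : K) : 1 + x * 0 != 0 by rewrite mulr0 addr0 oner_neq0.
have d1 (x : K) (y : V) : is_diff 0 (fun t => linfrac x t *: y) (fun t => t *: y).
  apply: DiffDef; first exact/differentiableZl/differentiable_linfrac.
  rewrite diffZl; last exact: differentiable_linfrac.
  apply/funext => t; rewrite diff1E; last exact: differentiable_linfrac.
  by rewrite derive1_linfrac0 /= [_ *: 1]mulr1.
have hd : is_diff 0 (cst b + (fun t => linfrac q t *: v) + (fun t => linfrac r t *: w))
   (0 + (fun t => t *: v) + (fun t => t *: w)).
  exact: is_diffD.
rewrite derive1E'; last by case: hd.
have [_ E] := hd; transitivity ((0 + (fun t : K => t *: v) + (fun t => t *: w)) 1).
  by rewrite -E.
by rewrite !fctE /= add0r !scale1r.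
Qed.

Lemma derive1_line (b v : V) (t : K) :
  differentiable (fun t : K => b + t *: v) t /\
  derive1 (fun t : K => b + t *: v) t = v.
Proof.
have hd : is_diff t (cst b + *:%R ^~ v) (0 + *:%R ^~ v).
  exact: is_diffD.
have [df E] := hd; split=> //.
rewrite derive1E' //; transitivity ((0 + *:%R ^~ v) (1 : K)); first by rewrite -E.
by rewrite !fctE /= add0r scale1r.
Qed.

Lemma diff_along_line (h : V -> K) (b v : V) (r q : K) : differentiable h b ->
  (forall t, h (b + t *: v) = linfrac q t * r) -> 'd h b v = r.
Proof.
move=> dh E; have [d1 d1E] := derive1_line b v 0.
have e : b + 0 *: v = b by rewrite scale0r addr0.
have := @derive1_comp_diff K V K (fun t => b + t *: v) h 0 d1.
rewrite e d1E => /(_ dh) <-.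
have -> : h \o (fun t => b + t *: v) = (fun t => linfrac q t *: r).
  by apply/funext => t /=; rewrite E.
have h0 : 1 + q * 0 != 0 by rewrite mulr0 addr0 oner_neq0.
rewrite derive1E'; last exact/differentiableZl/differentiable_linfrac.
rewrite diffZl; last exact: differentiable_linfrac.
rewrite diff1E; last exact: differentiable_linfrac.
by rewrite derive1_linfrac0 scale1r [_ *: _]mul1r.
Qed.

End LinearFractional.

Section BallWitnesses.
Variables (C : numClosedFieldType) (n : nat) (a : 'rV[C]_n) (s : C).
Hypotheses (s_gt0 : 0 < s) (hs : hdot a a = 1 - s ^+ 2).
Variables (xi : 'rV[C]_n) (rho : C).
Hypotheses (rho_gt0 : 0 < rho)
  (hrho : hdot (ball_lin a s xi) (ball_lin a s xi) = rho ^+ 2).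

Let L := ball_lin a s.
Let u := rho^-1 *: L xi.

Let rho0 : rho != 0.
Proof. exact: lt0r_neq0. Qed.

Let rhoJ : (rho^-1)^* = rho^-1.
Proof. by apply/CrealP; rewrite gtr0_real // invr_gt0. Qed.

Let u1 : hdot u u = 1.
Proof. by rewrite /u hdotZl hdotZr hrho rhoJ; field. Qed.

(** The image of the linear disc t |-> - t u under the involution, written so that it visibly runs
    along [xi], with velocity (s^2 / rho) xi at 0. The null last term gives it the shape of
    [derive1_linfracZ]. *)
Definition ball_disc (t : C) : 'rV[C]_n :=
  a + linfrac (hdot xi a / rho) t *: ((s ^+ 2 / rho) *: xi) + linfrac 0 t *: 0.

Let tu1 t : `|t| < 1 -> hdot (- t *: u) (- t *: u) < 1.
Proof.
by move=> ht; rewrite hdotZl hdotZr mulrA -normCK u1 mulr1 normrN expr_lt1.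
Qed.

Let uaE : hdot u a = hdot xi a / rho.
Proof. by rewrite /u hdotZl (hdot_ball_lin s_gt0 hs) mulrC. Qed.

Lemma ball_disc_den t : `|t| < 1 -> 1 + hdot xi a / rho * t != 0.
Proof.
move=> /tu1 /(denominator_neq0 s_gt0 hs).
by rewrite hdotZl uaE mulNr opprK [t * _]mulrC.
Qed.

Lemma ball_discE t : `|t| < 1 -> ball_disc t =
  (1 - hdot (- t *: u) a)^-1 *: (a - L (- t *: u)).
Proof.
move=> ht; have d0 := ball_disc_den ht.
rewrite hdotZl uaE mulNr opprK [t * _]mulrC.
apply: (scalerI d0); rewrite scalerA mulfV // scale1r.
have -> : L (- t *: u) = - t *: (rho^-1 *: (s ^+ 2 *: xi + hdot xi a *: a)).
  by rewrite /L ball_linZ /u ball_linZ (ball_lin2 s_gt0 hs).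
rewrite /ball_disc scaler0 addr0 /linfrac scaleNr opprK.
rewrite !scalerA !scalerDr !scalerA scalerDl scale1r -!addrA; congr (_ + _).
rewrite addrC; congr (_ *: _ + _ *: _).
  by move: d0; set d := 1 + _ => d0; field; rewrite rho0 d0.
by field.
Qed.

Lemma ball_disc_in t : `|t| < 1 -> hdot (ball_disc t) (ball_disc t) < 1.
Proof.
move=> ht; rewrite ball_discE //; apply: (ball_involution_lt1 s_gt0 hs).
exact: tu1.
Qed.

(** The component along u of the involution. Its derivative along [xi] has modulus rho / s^2, the
    inverse of the speed of [ball_disc], so the two bounds of the sandwich meet. *)
Definition ball_fun (w : 'rV[C]_n) : C :=
  (1 - hdot w a)^-1 * hdot (a - L w) u.

Lemma ball_fun_lt1 w : hdot w w < 1 -> `|ball_fun w| < 1.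
Proof.
move=> hw; rewrite -(expr_lt1 (n := 2)) // /ball_fun -hdotZl.
apply: le_lt_trans (hdot_unit_le _ u1) _.
exact: ball_involution_lt1 hw.
Qed.

Lemma differentiable_ball_fun w : hdot w w < 1 -> differentiable ball_fun w.
Proof.
move=> hw.
have dh (v : 'rV[C]_n) : differentiable (fun y : 'rV[C]_n => hdot y v) w.
  exact: differentiable_hdot.
apply: differentiableM.
  apply: differentiableV; last exact: denominator_neq0 hs _ hw.
  by apply: differentiableB; [exact: differentiable_cst|exact: dh].
have -> : (fun w : 'rV[C]_n => hdot (a - L w) u) =
  cst (hdot a u) - (cst s * (fun y : 'rV[C]_n => hdot y u) +
    (fun y => hdot y a) * cst ((1 + s)^-1 * hdot a u)).
  apply/funext => v; rewrite !fctE /L /ball_lin !(hdotDl, hdotNl, hdotZl).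
  by rewrite mulrA.
apply: differentiableB; first exact: differentiable_cst.
apply: differentiableD; apply: differentiableM => //; exact: differentiable_cst.
Qed.

Lemma hdot_center_lt1 : hdot a a < 1.
Proof. by rewrite hs ltrBlDr ltrDl exprn_gt0. Qed.

Lemma diff_ball_fun : 'd ball_fun a xi = - (rho / s ^+ 2).
Proof.
apply: (@diff_along_line _ _ _ _ _ _ (- (hdot xi a / s ^+ 2))).
  exact/differentiable_ball_fun/hdot_center_lt1.
move=> t; rewrite /ball_fun /linfrac /L ball_linD (ball_lin_center s_gt0 hs).
rewrite opprD addrA subrr add0r ball_linZ hdotNl hdotZl.
have -> : hdot (ball_lin a s xi) u = rho.
  by rewrite /u hdotZr rhoJ hrho; field.
have -> : 1 - hdot (a + t *: xi) a = s ^+ 2 * (1 + - (hdot xi a / s ^+ 2) * t).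
  rewrite hdotDl hs hdotZl; field; exact: lt0r_neq0.
rewrite invfM !mulrN mulNr; congr (- _); ring.
Qed.

End BallWitnesses.

Section BallMetric.
Variables (R : realType) (n : nat) (z : 'rV[cplx R]_n).
Hypothesis (hz : unit_ball z).
Variable F : forall n, set 'rV[cplx R]_n -> 'rV[cplx R]_n -> 'rV[cplx R]_n -> R.
Hypothesis hF : sandwiched F.

Lemma unit_ballE (w : 'rV[cplx R]_n) : unit_ball w <-> hdot w w < 1.
Proof. by rewrite hsqE. Qed.

(** Treated apart because the extremal disc normalizes the image of the direction. The constant disc
    has every a > 0 as its speed along 0, so the metric is at most 1 / a for all a. *)
Lemma sandwiched0 : F (@unit_ball R n) z 0 = 0.
Proof.
have hd a : is_disc (@unit_ball R n) z 0 a (cst z).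
  split.
  - by move=> t _; exact: differentiable_cst.
  - by move=> _ [t _ <-].
  - by [].
  - by rewrite derive1_cst scaler0.
have h0 : is_bounded_fun (@unit_ball R n) (cst 0).
  split; first by move=> w _; exact: differentiable_cst.
  by move=> _ [w _ <-]; exact: disc0.
apply/eqP; rewrite eq_le; apply/andP; split; last first.
  have := hF.2 _ _ _ _ _ _ _ ltr01 (hd 1) h0.
  by rewrite linear0 cmod0.
rewrite leNgt; apply/negP => F0; set r := F _ _ _ in F0.
have r2 : 0 < (r / 2)^-1 by rewrite invr_gt0; lra.
have := hF.1 _ _ _ _ _ _ r2 (hd _); rewrite invrK -/r; lra.
Qed.

Lemma ball_metric : exists s : cplx R, forall xi,
  ((F (@unit_ball R n) z xi ^+ 2)%:C)%C =
    hdot (ball_lin z s xi) (ball_lin z s xi) / s ^+ 4.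
Proof.
have hz1 := (unit_ballE z).1 hz.
pose s : cplx R := sqrtC (1 - hdot z z).
have s0 : 0 < s by rewrite sqrtC_gt0 subr_gt0.
have hs : hdot z z = 1 - s ^+ 2 by rewrite sqrtCK opprB addrC subrK.
exists s => xi; set N := hdot _ _.
have N0 : 0 <= N by exact: hsq_ge0.
have NE : N = s ^+ 2 * hdot xi xi + `|hdot xi z| ^+ 2 by exact: hsq_ball_lin.
have [xi0|xi0] := eqVneq xi 0.
  rewrite NE xi0 sandwiched0 expr0n /= -(scale0r 0) !hdotZl !mul0r mulr0 normr0.
  by rewrite expr0n /= addr0 mul0r.
have {}N0 : 0 < N.
  rewrite lt_neqAle N0 andbT eq_sym; apply/eqP => NN0; move/eqP: xi0; apply.
  apply: hsq_eq0; apply/eqP; move/eqP: NN0; rewrite NE.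
  rewrite paddr_eq0 ?mulr_ge0 ?hsq_ge0 ?exprn_ge0 ?(ltW s0) //.
  by rewrite mulf_eq0 expf_eq0 /= (gt_eqF s0) /= => /andP[].
pose rho : cplx R := sqrtC N.
have rho0 : 0 < rho by rewrite sqrtC_gt0.
have hrho : N = rho ^+ 2 by rewrite sqrtCK.
have q0 : 0 < rho / s ^+ 2 by rewrite divr_gt0 // exprn_gt0.
pose b := cmod (rho / s ^+ 2).
have bE : (b%:C)%C = rho / s ^+ 2 by rewrite cmodE gtr0_norm.
have b0 : 0 < b by rewrite -ltcR bE.
have bV : 0 < b^-1 by rewrite invr_gt0.
have hd : is_disc (@unit_ball R n) z xi b^-1 (ball_disc z s xi rho).
  split.
  - move=> t ht; apply: differentiable_linfracZ.
      exact: (ball_disc_den s0 hs rho0 hrho ht).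
    by rewrite mul0r addr0 oner_neq0.
  - by move=> _ [t ht <-]; apply/unit_ballE; exact: (ball_disc_in s0 hs rho0 hrho ht).
  - by rewrite /ball_disc !linfrac0 !scale0r !addr0.
  - rewrite derive1_linfracZ addr0 fmorphV /= bE; congr (_ *: _).
    by rewrite invf_div.
have hf : is_bounded_fun (@unit_ball R n) (ball_fun z s xi rho).
  split; first by move=> w /unit_ballE hw; exact: (differentiable_ball_fun s0 hs xi rho hw).
  by move=> _ [w /unit_ballE hw <-]; exact: (ball_fun_lt1 s0 hs rho0 hrho hw).
have h1 := hF.1 _ _ _ _ _ _ bV hd; rewrite invrK in h1.
have h2 := hF.2 _ _ _ _ _ _ _ bV hd hf.
rewrite (diff_ball_fun s0 hs rho0 hrho) cmodN -/b in h2.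
have -> : F (@unit_ball R n) z xi = b by apply/eqP; rewrite eq_le h1 h2.
by rewrite rmorphXn /= bE expr_div_n -hrho -exprM.
Qed.

Lemma Re_parallelogram (x y u v : cplx R) : x + y = u + u + (v + v) ->
  complex.Re x + complex.Re y = 2 * complex.Re u + 2 * complex.Re v.
Proof.
move/(congr1 (@complex.Re R)); rewrite (cReD x) (cReD (u + u)) (cReD u) (cReD v) => ->.
by ring.
Qed.

Lemma ball_parallelogram xi eta :
  F (@unit_ball R n) z (xi + eta) ^+ 2 + F (@unit_ball R n) z (xi - eta) ^+ 2 =
  2 * F (@unit_ball R n) z xi ^+ 2 + 2 * F (@unit_ball R n) z eta ^+ 2.
Proof.
have [s hs] := ball_metric.
have hR x : F (@unit_ball R n) z x ^+ 2 =
    complex.Re (hdot (ball_lin z s x) (ball_lin z s x) / s ^+ 4) by rewrite -hs.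
rewrite (hR (xi + eta)) (hR (xi - eta)) (hR xi) (hR eta); apply: Re_parallelogram.
exact: ball_lin_parallelogram.
Qed.

End BallMetric.

(** * Farthest boundary points *)

Lemma bounded_closure (R : realType) (V : normedModType R) (A : set V) :
  bounded_set A -> bounded_set (closure A).
Proof.
move=> [M [_ hM]]; exists (`|M| + 2); split; first exact: num_real.
move=> B hB y /(_ _ (nbhsx_ballx y 1 ltr01)) [x [Ax]].
rewrite -ball_normE /ball_ /= => yx.
have M1 : M < `|M| + 1 by have := ler_norm M; lra.
have := hM _ M1 x Ax; have := ler_normD (y - x) x; rewrite subrK /=; lra.
Qed.

Section RealInner.
Variables (R : realType) (n : nat).
Implicit Types x y : 'rV[R]_n.

Definition rdot x y : R := \sum_j x 0 j * y 0 j.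

Lemma rdotDl x y z : rdot (x + y) z = rdot x z + rdot y z.
Proof. by rewrite -big_split; apply: eq_bigr => j _; rewrite mxE mulrDl. Qed.

Lemma rdotC x y : rdot x y = rdot y x.
Proof. by apply: eq_bigr => j _; rewrite mulrC. Qed.

Lemma rdotZl c x y : rdot (c *: x) y = c * rdot x y.
Proof. by rewrite mulr_sumr; apply: eq_bigr => j _; rewrite mxE mulrA. Qed.

Lemma rdotDr x y z : rdot z (x + y) = rdot z x + rdot z y.
Proof. by rewrite rdotC rdotDl !(rdotC z). Qed.

Lemma rdotZr c x y : rdot y (c *: x) = c * rdot y x.
Proof. by rewrite rdotC rdotZl rdotC. Qed.

Lemma rdot0r x : rdot x 0 = 0.
Proof. by rewrite /rdot big1 // => j _; rewrite mxE mulr0. Qed.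

Lemma rdot_gt0 x : x != 0 -> 0 < rdot x x.
Proof.
move=> x0; have h (j : 'I_n) : true -> 0 <= x 0 j * x 0 j by rewrite -expr2 sqr_ge0.
rewrite lt_neqAle sumr_ge0 // andbT eq_sym psumr_eq0 //.
apply: contraNN x0 => /allP hx; apply/eqP/rowP => j; rewrite mxE.
by have := hx j (mem_index_enum _); rewrite mulf_eq0 orbb => /eqP.
Qed.

Lemma continuous_rdot_diag : continuous (fun x => rdot x x).
Proof.
move=> x; apply: differentiable_continuous.
have -> : (fun x => rdot x x) = \sum_(j < n) (fun u : 'rV[R]_n => u 0 j * u 0 j).
  by apply/funext => u; rewrite fct_sumE.
by apply: differentiable_sum => j; apply: differentiableM; exact: differentiable_coord.
Qed.

(** The half-space supported at a farthest point: expand |x - q|^2 > 0 and use |x| <= |q|. *)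
Lemma rdot_lt_farthest (A : set 'rV[R]_n) q x :
  (forall y, closure A y -> rdot y y <= rdot q q) -> ~ A q -> A x ->
  rdot x q < rdot q q.
Proof.
move=> hq nq hx; have xq : x - q != 0.
  by rewrite subr_eq0; apply/eqP => e; apply: nq; rewrite -e.
have := rdot_gt0 xq; have := hq x (subset_closure hx).
rewrite -scaleN1r !rdotDl !rdotDr !rdotZl !rdotZr (rdotC q x); lra.
Qed.

Lemma open_dilation (A : set 'rV[R]_n) q : open A -> A q -> q != 0 ->
  exists2 y, A y & rdot q q < rdot y y.
Proof.
move=> oA Aq q0.
have : nbhs q A by exact: open_nbhs_nbhs.
move=> /nbhs_normP[e /= e0 he].
have nq : 0 < `|q| by rewrite normr_gt0.
pose t := e / (2 * `|q|); have t0 : 0 < t by rewrite divr_gt0 // mulr_gt0.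
exists (q + t *: q).
  apply: he; rewrite /ball_ /= opprD addNKr normrN normrZ gtr0_norm //.
  have -> : t * `|q| = e / 2 by rewrite /t; field; exact: lt0r_neq0.
  lra.
have := rdot_gt0 q0; rewrite !rdotDl !rdotDr !rdotZl !rdotZr.
have : 0 < t * rdot q q by rewrite mulr_gt0 // rdot_gt0.
have : 0 < t * (t * rdot q q) by do 2 apply: mulr_gt0 => //; exact: rdot_gt0.
lra.
Qed.

End RealInner.

Section BoundaryPoint.
Variables (R : realType) (n : nat) (A U : set 'rV[R]_n) (rho : 'rV[R]_n -> R) (q : 'rV[R]_n).
Hypotheses (oU : open U) (Uq : U q) (drho : differentiable rho q).
Hypotheses (hA : A `&` U = [set x | U x /\ rho x < 0]) (rq : rho q = 0).

(** To first order [rho] decreases by at least e m along e v. The accuracy m / (2 B1) keeps the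
    error at most half of that, uniformly over the bounded set [K]. *)
Lemma enters_uniformly (K : set 'rV[R]_n) (B m : R) : 0 < m ->
  (forall v, K v -> `|v| <= B) -> (forall v, K v -> 'd rho q v <= - m) ->
  exists2 e0 : R, 0 < e0 & forall e v, 0 < e < e0 -> K v -> A (q + e *: v).
Proof.
move=> m0 hB hm; pose B1 := `|B| + 1.
have B10 : 0 < B1 by rewrite ltr_wpDl.
have em : 0 < m / (2 * B1) by rewrite divr_gt0 // mulr_gt0.
have [d d0 hd] := diff_eps drho em.
have : nbhs q U by exact: open_nbhs_nbhs.
move=> /nbhs_normP[d2 /= d20 hU].
exists (Num.min d d2 / B1); first by rewrite divr_gt0 // lt_min d0.
move=> e v /andP[e0 ee] Kv.
have vB : `|v| <= B1.
  by apply: le_trans (hB v Kv) _; have := ler_norm B; rewrite /B1; lra.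
have ev : `|e *: v| < Num.min d d2.
  rewrite normrZ gtr0_norm //; move: ee; rewrite ltr_pdivlMr //; apply: le_lt_trans.
  by rewrite ler_pM2l.
move: ev; rewrite lt_min => /andP[ev1 ev2].
have Uv : U (q + e *: v) by apply: hU; rewrite /ball_ /= opprD addNKr normrN.
suff : (A `&` U) (q + e *: v) by case.
rewrite hA; split=> //; have := hd _ ev1.
rewrite rq subr0 linearZ /= normrZ (gtr0_norm e0).
have h1 : e * 'd rho q v <= e * - m by rewrite ler_pM2l // hm.
have h2 : m / (2 * B1) * (e * `|v|) <= m / 2 * e.
  have -> : m / 2 * e = m / (2 * B1) * (e * B1) by field; exact: lt0r_neq0.
  by rewrite ler_pM2l // ler_pM2l.
rewrite ler_norml => /andP[_]; rewrite /GRing.scale /= => h3.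
have : 0 < m * e by exact: mulr_gt0.
lra.
Qed.

Hypotheses (far : forall y, closure A y -> rdot y y <= rdot q q)
  (q0 : q != 0) (dnz : exists v, 'd rho q v != 0).

(** Otherwise small steps along v would enter [A], and since <q, v> >= 0 they would lead farther
    from the origin than q. *)
Lemma outward_ge0 v : v != 0 -> 0 <= rdot q v -> 0 <= 'd rho q v.
Proof.
move=> v0 qv; rewrite leNgt; apply/negP => lv.
have lv' : 0 < - 'd rho q v by rewrite oppr_gt0.
have [|w ->|e0 e00 he] := @enters_uniformly [set v] `|v| _ lv'; first by move=> w ->.
  by rewrite opprK.
have /far : closure A (q + (e0 / 2) *: v).
  by apply: subset_closure; apply: he => //; lra.
have := rdot_gt0 v0; rewrite !rdotDl !rdotDr !rdotZl !rdotZr (rdotC v q) => vv.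
have e2 : 0 < e0 / 2 by lra.
have : 0 < (e0 / 2) * ((e0 / 2) * rdot v v) by do 2 apply: mulr_gt0 => //.
have : 0 <= (e0 / 2) * rdot q v by rewrite mulr_ge0 // ltW.
lra.
Qed.

(** If this derivative were zero, a small multiple of some v0 with negative derivative could be
    added to q: the sum still has positive product with q but negative derivative, against
    [outward_ge0]. *)
Lemma outward_gt0 : 0 < 'd rho q q.
Proof.
rewrite lt_neqAle outward_ge0 ?(ltW (rdot_gt0 q0)) // andbT eq_sym; apply/eqP => dq.
have [v0 hv0] := dnz.
wlog lv0 : v0 hv0 / 'd rho q v0 < 0.
  move=> h; move: (hv0); rewrite neq_lt => /orP[|] hl; first exact: h hl.
  by apply: (h (- v0)); rewrite linearN ?oppr_eq0 ?oppr_lt0.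
have qq := rdot_gt0 q0.
pose t := rdot q q / (`|rdot q v0| + 1).
have t0 : 0 < t by rewrite divr_gt0 // ltr_wpDl.
have tv : t * `|rdot q v0| < rdot q q.
  rewrite /t mulrAC ltr_pdivrMr ?ltr_wpDl //; nra.
have pos : 0 < rdot q (q + t *: v0).
  rewrite rdotDr rdotZr; have : - (t * `|rdot q v0|) <= t * rdot q v0.
    by rewrite -mulrN ler_pM2l // lerNnormlW.
  lra.
have nz : q + t *: v0 != 0.
  by apply/eqP => e; move: pos; rewrite e rdot0r ltxx.
have := outward_ge0 nz (ltW pos); rewrite linearD linearZ /= dq add0r.
by rewrite pmulr_rge0 // leNgt lv0.
Qed.

(** [outward_ge0] applies to both v and - v. *)
Lemma tangent0 v : v != 0 -> rdot q v = 0 -> 'd rho q v = 0.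
Proof.
move=> v0 qv; apply/eqP; rewrite eq_le outward_ge0 ?qv // andbT.
rewrite -oppr_ge0 -linearN outward_ge0 ?oppr_eq0 //.
by rewrite -scaleN1r rdotZr qv mulr0.
Qed.

End BoundaryPoint.

(** * Complex row vectors as real ones *)

Section RealPicture.
Variables (R : realType) (n : nat).
Implicit Types u v w : 'rV[cplx R]_n.

Lemma realifyD u v : realify (u + v) = realify u + realify v.
Proof.
by rewrite /realify add_row_mx; congr row_mx; apply/rowP => j; rewrite !mxE ?cReD ?cImD.
Qed.

Lemma realifyN u : realify (- u) = - realify u.
Proof.
by rewrite /realify opp_row_mx; congr row_mx; apply/rowP => j; rewrite !mxE ?cReN ?cImN.
Qed.

Lemma realifyZ (c : cplx R) w : realify (c *: w) =
  complex.Re c *: realify w + complex.Im c *: realify (('i%C : cplx R) *: w).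
Proof.
rewrite /realify !scale_row_mx add_row_mx.
congr row_mx; apply/rowP => j; rewrite !mxE.
  by rewrite !cReM /=; ring.
by rewrite !cImM /=; ring.
Qed.

Lemma realifyZr (r : R) w : realify ((r%:C)%C *: w) = r *: realify w.
Proof. by rewrite realifyZ /= scale0r addr0. Qed.

Lemma realify0 : realify (0 : 'rV[cplx R]_n) = 0.
Proof. by have := realifyZr 0 0; rewrite scaler0 scale0r. Qed.

Lemma conjE (z : cplx R) : z^* = conjc z.
Proof. by []. Qed.

Lemma Re_sum (I : finType) (f : I -> cplx R) :
  complex.Re (\sum_i f i) = \sum_i complex.Re (f i).
Proof. by apply: (big_morph (@complex.Re R) (@cReD R)). Qed.

Lemma rdot_realify u v : rdot (realify u) (realify v) = complex.Re (hdot u v).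
Proof.
rewrite /rdot big_split_ord /= /hdot Re_sum -big_split; apply: eq_bigr => j _ /=.
rewrite /realify !row_mxEl !row_mxEr !mxE cReM conjE.
by case: (u 0 j) => a b; case: (v 0 j) => c d /=; ring.
Qed.

Lemma Im_hsq u : complex.Im (hdot u u) = 0.
Proof. by apply: ger0_Im; exact: hsq_ge0. Qed.

Lemma realset_realify (D : set 'rV[cplx R]_n) w : realset D (realify w) <-> D w.
Proof. by rewrite /realset /= realifyK. Qed.


Lemma realset_open (D : set 'rV[cplx R]_n) : open D -> open (realset D).
Proof.
move=> oD; rewrite openE => x Dx; have : nbhs (complexify x) D.
  by apply: open_nbhs_nbhs; split.
move=> /nbhs_ballP[e /= e0 he]; have eE : ((cmod e)%:C)%C = e.
  by rewrite cmodE gtr0_norm.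
have c0 : 0 < cmod e by rewrite -ltcR eE.
apply/nbhs_ballP; exists (cmod e / 2); first by rewrite /= divr_gt0.
move=> y [_ hy]; apply: he; split=> // i j.
rewrite -ball_normE /ball_ /= !mxE -eE ltc_cmod.
apply: le_lt_trans (cmod_le_ReIm _) _; rewrite !cReD !cReN !cImD !cImN /=.
rewrite [ltRHS](splitr _); apply: ltrD.
  by have := hy 0 (lshift n j); rewrite -ball_normE.
by have := hy 0 (rshift n j); rewrite -ball_normE.
Qed.

Lemma norm_coord_le (K : numFieldType) m p (x : 'M[K]_(m, p)) i j :
  `|x i j| <= `|x|.
Proof.
rewrite [leRHS]/Num.Def.normr /= mx_normE -[leLHS]nngE num_le.
exact: (le_bigmax _ (fun i : 'I_m * 'I_p => `|x i.1 i.2|%:nng) (i, j)).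
Qed.

Lemma realset_bounded (D : set 'rV[cplx R]_n) :
  bounded_set D -> bounded_set (realset D).
Proof.
move=> [M [Mreal hM]]; have M1 : M < `|M| + 1.
  by apply: le_lt_trans (real_ler_norm Mreal) _; rewrite ltrDl ltr01.
have := hM _ M1 => {}hM.
exists (cmod (`|M| + 1)); split; first exact: num_real.
move=> B hB x Dx /=; rewrite [leLHS]/Num.Def.normr /= mx_normrE; apply/bigmax_leP.
have B0 := cmod_ge0 (`|M| + 1).
have hc k : cmod (complexify x 0 k) <= B.
  apply: le_trans (ltW hB); rewrite -lecR !cmodE [leRHS]ger0_norm ?addr_ge0 //.
  exact: le_trans (norm_coord_le _ _ _) (hM _ Dx).
split=> [|[i j] _ /=]; first by lra.
rewrite (ord1 i) -[j]splitK /unsplit; case: (fintype.split j) => k.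
  apply: le_trans (hc k); have := Re_le_cmod (complexify x 0 k).
  by rewrite !mxE.
apply: le_trans (hc k); have := Im_le_cmod (complexify x 0 k).
by rewrite !mxE.
Qed.

End RealPicture.

Section TouchingPoint.
Variables (R : realType) (n : nat) (D : set 'rV[cplx R]_n).
Hypotheses (n_gt0 : (0 < n)%N) (hD : is_domain D) (bD : bounded_set D).
Variable k : nat.
Hypothesis smooth : smooth_boundary k.+1 D.

Lemma realset_nonzero : exists2 x, realset D x & x != 0.
Proof.
have [oD _ [w Dw]] := hD.
have [w0|w0] := eqVneq (realify w) 0; last first.
  by exists (realify w) => //; exact/realset_realify.
have : nbhs (0 : 'rV[R]_(n + n)) (realset D).
  by apply: open_nbhs_nbhs; split; [exact: realset_open|rewrite -w0 realset_realify].
move=> /nbhs_ballP[e /= e0 he].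
exists (const_mx (e / 2)).
  apply: he; split=> // i j; rewrite -ball_normE /ball_ /= !mxE sub0r normrN.
  by rewrite gtr0_norm //; lra.
apply/eqP => /rowP/(_ (lshift n (Ordinal n_gt0))); rewrite !mxE; lra.
Qed.

Lemma farthest_point : exists q : 'rV[R]_(n + n),
  [/\ boundary (realset D) q, ~ realset D q, q != 0
    & forall y, closure (realset D) y -> rdot y y <= rdot q q].
Proof.
have [oD _ _] := hD; have oA := realset_open oD.
have cA : compact (closure (realset D)).
  apply: bounded_closed_compact; last exact: closed_closure.
  exact/bounded_closure/realset_bounded.
have [x Ax x0] := realset_nonzero.
have [q] := @EVT_max_rV R _ (fun x => rdot x x) _ (ex_intro _ x (subset_closure Ax)) cA
  (continuous_subspaceT (@continuous_rdot_diag _ _)).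
rewrite inE => qA hq.
have far y : closure (realset D) y -> rdot y y <= rdot q q.
  by move=> hy; apply: hq; rewrite inE.
have q0 : q != 0.
  apply/eqP => q0; have := far x (subset_closure Ax).
  by rewrite q0 rdot0r leNgt rdot_gt0.
have nq : ~ realset D q.
  move=> Aq; have [y Ay] := open_dilation oA Aq q0.
  by rewrite ltNge far //; exact: subset_closure.
by exists q; split=> //; split=> // /interior_subset.
Qed.

(** The second clause is the supporting half-space and yields test functions; the third says that
    [D] contains small dilates, with vertex q, of bounded parts of the half-plane Re c >= m, and
    yields discs. *)
Lemma touching_point : exists q : 'rV[cplx R]_n, [/\ q != 0,
  forall w, D w -> 0 < complex.Re (1 - hdot w q / hdot q q) &
  forall B m : R, 0 < m -> exists2 e0 : R, 0 < e0 & forall (e : R) (c : cplx R),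
    0 < e < e0 -> cmod c <= B -> m <= complex.Re c ->
    D (q - (e%:C)%C *: (c *: q))].
Proof.
have [qr [bq nq q0 far]] := farthest_point.
have [U [rho [oU [drho _] hA hb dnz]]] := smooth.
have : [set x | U x /\ rho x = 0] qr by rewrite -hb.
move=> [Uq rq]; have {}drho := drho _ Uq; have {}dnz := dnz _ bq.
pose q := complexify qr; have qE : realify q = qr by exact: complexifyK.
have lq := outward_gt0 oU Uq drho hA rq far q0 dnz.
have S0 := rdot_gt0 q0; set S := rdot qr qr in S0 far *.
have hqq : hdot q q = (S%:C)%C.
  rewrite [LHS]complexE Im_hsq mulr0 addr0 -rdot_realify qE //.
exists q; split.
- by apply: contraNneq q0 => q0'; rewrite -qE q0' realify0.
- move=> w Dw; have := rdot_lt_farthest far nq ((realset_realify _ _).2 Dw).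
  rewrite -qE rdot_realify => hlt.
  have -> : 1 - hdot w q / hdot q q = ((S^-1)%:C)%C * ((S%:C)%C - hdot w q).
    by rewrite hqq fmorphV; field; rewrite (eq_complex) /= eqxx andbT gt_eqF.
  rewrite cReM /= mul0r subr0 cReD cReN /= mulr_gt0 ?invr_gt0 // subr_gt0.
  by rewrite qE in hlt.
- move=> B m m0.
  pose q' := realify (('i%C : cplx R) *: q).
  pose K := [set v | exists c : cplx R,
    [/\ v = - realify (c *: q), cmod c <= B & m <= complex.Re c]].
  (* The real part of <q, i q> is zero, so i q is tangent and only Re c contributes to the
     derivative of [rho] along - c q. *)
  have tq : 'd rho qr q' = 0.
    have rq' : rdot qr q' = 0.
      rewrite -qE rdot_realify hdotZr hqq conjE /=; ring.
    have [->|q'0] := eqVneq q' 0; first by rewrite linear0.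
    exact: (tangent0 oU Uq drho hA rq far q'0 rq').
  have [|||e0 e00 he] := @enters_uniformly _ _ _ _ _ _ oU Uq drho hA rq K
    (B * (`|qr| + `|q'|)) (m * 'd rho qr qr).
  - by rewrite mulr_gt0.
  - move=> _ [c [-> cB _]]; rewrite normrN realifyZ qE -/q'.
    apply: le_trans (ler_normD _ _) _; rewrite !normrZ mulrDr.
    apply: lerD; apply: ler_wpM2r => //.
      exact: le_trans (Re_le_cmod _) cB.
    exact: le_trans (Im_le_cmod _) cB.
  - move=> _ [c [-> _ mc]]; rewrite linearN realifyZ qE -/q' linearD !linearZ /= tq.
    by rewrite scaler0 addr0 scalerN lerN2 ler_wpM2r // ltW.
  exists e0 => // e c ee cB mc.
  apply/realset_realify; rewrite realifyD realifyN realifyZr qE -scalerN.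
  by apply: he => //; exists c.
Qed.

End TouchingPoint.

(** * The metrics of the product *)

Section Cayley.

(** Expresses the Cayley map (1 - r t) / (1 + r t) as an affine function of [linfrac r t]. *)
Lemma cayley_linfrac (K : numFieldType) (r t : K) : 1 + r * t != 0 ->
  (1 - 2 * r * linfrac r t) * (1 + r * t) = 1 - r * t.
Proof. by move=> h; rewrite /linfrac; field. Qed.

Lemma cayley_scale (K : numFieldType) (V : lmodType K) (q : V) (e r l : K) :
  (1 - e) *: q + l *: ((2 * r * e) *: q) = q - e *: ((1 - 2 * r * l) *: q).
Proof.
have H k : q - k *: q = (1 - k) *: q by rewrite scalerBl scale1r.
by rewrite !scalerA -scalerDl H; congr (_ *: _); ring.
Qed.

Lemma differentiable_cayley (K : numFieldType) (V : normedModType K) (h : V -> K)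
    (x : K) v : differentiable h v -> h v + x != 0 ->
  differentiable (fun w => (h w - x) / (h w + x)) v.
Proof.
move=> dh hx; apply: differentiableM; last apply: differentiableV => //.
  by apply: differentiableB => //; exact: differentiable_cst.
by apply: differentiableD => //; exact: differentiable_cst.
Qed.

Variable R : realType.
Implicit Types z w c : cplx R.

Lemma cmod_sqr z : cmod z ^+ 2 = complex.Re z ^+ 2 + complex.Im z ^+ 2.
Proof. by apply: complexI; rewrite rmorphXn /= cmodE -add_Re2_Im2. Qed.

Lemma cmod_lt (z w : cplx R) : complex.Re z ^+ 2 + complex.Im z ^+ 2 <
  complex.Re w ^+ 2 + complex.Im w ^+ 2 -> cmod z < cmod w.
Proof.
rewrite -!cmod_sqr => h; rewrite ltNge; apply/negP => wz; move: h; apply/negP.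
by rewrite -leNgt; apply: lerXn2r => //; rewrite nnegrE cmod_ge0.
Qed.

(** Here |c| <= (7/4) / (1/4) = 7, and Re c = (1 - |w|^2) / |1 - w|^2 >= (7/16) / (49/16) = 1/7. *)
Lemma cayley_bounds c w : cmod w <= 3 / 4 -> c * (1 - w) = 1 + w ->
  cmod c <= 7 /\ 7^-1 <= complex.Re c.
Proof.
move=> hw E; have w0 := cmod_ge0 w; have c0 := cmod_ge0 c.
have w2 : complex.Re w ^+ 2 + complex.Im w ^+ 2 <= 9 / 16.
  rewrite -cmod_sqr; nra.
have c1 : cmod (1 : cplx R) = 1 by rewrite /cmod normr1.
have lo : 1 / 4 <= cmod (1 - w).
  have : cmod (1 : cplx R) <= cmod (1 - w) + cmod w.
    by have := cmodD (1 - w) w; rewrite subrK.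
  by rewrite c1; lra.
have up : cmod (1 - w) <= 7 / 4.
  by have := cmodD 1 (- w); rewrite cmodN c1; lra.
split.
  have : cmod (1 + w) <= 7 / 4 by have := cmodD 1 w; rewrite c1; lra.
  by rewrite -E cmodM; nra.
have up2 : cmod (1 - w) ^+ 2 <= 49 / 16.
  by have := cmod_ge0 (1 - w); nra.
have lo2 : 1 / 16 <= cmod (1 - w) ^+ 2 by nra.
have := congr1 (@complex.Re R) E; have := congr1 (@complex.Im R) E.
rewrite cReM cImM !cReD !cImD !cReN !cImN /=.
move: up2 lo2; rewrite cmod_sqr cReD cImD cReN cImN /=.
move: (complex.Re w) (complex.Im w) (complex.Re c) (complex.Im c) w2 => a b x y w2.
move=> up2 lo2 e2 e1.
have key : x * ((1 - a) ^+ 2 + (0 - b) ^+ 2) = 1 - a ^+ 2 - b ^+ 2.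
  have -> : x * ((1 - a) ^+ 2 + (0 - b) ^+ 2) =
    (x * (1 - a) - y * (0 - b)) * (1 - a) - (x * (0 - b) + y * (1 - a)) * b by ring.
  by rewrite e1 e2; ring.
move: key up2 lo2; set d := (1 - a) ^+ 2 + _ => key up2 lo2; nra.
Qed.

End Cayley.

(** * Discs and test functions in the product *)

Section ProductWitnesses.
Variables (R : realType) (m : nat) (N : 'I_m -> nat).
Variable D : forall i : 'I_m, set 'rV[cplx R]_(N i).
Variable q : forall i, 'rV[cplx R]_(N i).
Variable e : R.
Hypothesis e0 : 0 < e.
Hypothesis q0 : forall i, q i != 0.
Hypothesis half : forall i w, D w -> 0 < complex.Re (1 - hdot w (q i) / hdot (q i) (q i)).
Hypothesis sector : forall i (c : cplx R), cmod c <= 7 -> 7^-1 <= complex.Re c ->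
  D (q i - (e%:C)%C *: (c *: q i)).

Let ec : cplx R := (e%:C)%C.
Let r : cplx R := ((3 / 4 : R)%:C)%C.

Definition product_point : 'rV[cplx R]_(\sum_i N i) := \mxrow_i ((1 - ec) *: q i).

(** Predicates on the blocks make q_1 - q_2, q_1 + q_2 and a single q_i all differences of two such
    vectors, so one family of discs serves every direction. *)
Definition block_vec (S : pred 'I_m) : 'rV[cplx R]_(\sum_i N i) :=
  \mxrow_i (if S i then q i else 0).

(* With [psi z = (1 + r z) / (1 - r z)], block [i] is [q i - e psi(- t) q i] on
   [S], [q i - e psi(t) q i] on [T] and [(1 - e) q i] elsewhere. *)
Definition product_disc (S T : pred 'I_m) (t : cplx R) :=
  product_point + linfrac r t *: ((2 * r * ec) *: block_vec S)
  + linfrac (- r) t *: (- ((2 * r * ec) *: block_vec T)).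

Lemma submxrowZ (c : cplx R) (x : 'rV[cplx R]_(\sum_i N i)) i :
  submxrow (c *: x) i = c *: submxrow x i.
Proof. by apply/rowP => j; rewrite !mxE. Qed.

Lemma cmod_rt (t : cplx R) : unit_disc t -> cmod (r * t) <= 3 / 4.
Proof.
move=> /unit_discE ht; rewrite cmodM cmod_real ger0_norm; last by lra.
have := cmod_ge0 t; nra.
Qed.

Lemma den_neq0 (w : cplx R) : cmod w <= 3 / 4 -> 1 + w != 0.
Proof.
move=> hw; apply/eqP => h; have : w = - 1 by apply/eqP; rewrite -addr_eq0 addrC h.
by move=> e1; move: hw; rewrite e1 cmodN /cmod normr1 /=; lra.
Qed.

(** The values r, - r and 0 of s treat the blocks in S, those in T and the remaining ones. *)
Lemma sector_linfrac (s t : cplx R) i : cmod (s * t) <= 3 / 4 ->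
  D ((1 - ec) *: q i + linfrac s t *: ((2 * s * ec) *: q i)).
Proof.
move=> hst; rewrite cayley_scale.
have [] := @cayley_bounds R (1 - 2 * s * linfrac s t) (- (s * t)).
- by rewrite cmodN.
- by rewrite opprK cayley_linfrac // den_neq0.
- exact: sector.
Qed.

Lemma product_disc_in S T : (forall i, ~~ (S i && T i)) -> forall t, unit_disc t ->
  product_domain D (product_disc S T t).
Proof.
move=> ST t ht i; have rt := cmod_rt ht.
have rtN : cmod (- r * t) <= 3 / 4 by rewrite mulNr cmodN.
rewrite /product_disc !submxrowD !submxrowZ submxrowN submxrowZ !mxrowK.
have := ST i; case: (S i); case: (T i) => // _.
- by rewrite scaler0 oppr0 scaler0 addr0; exact: sector_linfrac.
- rewrite !scaler0 addr0 -scaleNr; have -> : - (2 * r * ec) = 2 * - r * ec.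
    by rewrite mulrN mulNr.
  exact: sector_linfrac.
- have := @sector_linfrac 0 t i; rewrite mul0r cmod0 mulr0 mul0r scale0r !scaler0.
  by rewrite !addr0 oppr0 scaler0 addr0; apply; apply: divr_ge0.
Qed.

Lemma product_disc_is_disc S T : (forall i, ~~ (S i && T i)) ->
  is_disc (product_domain D) product_point (block_vec S - block_vec T)
    (3 / 2 * e) (product_disc S T).
Proof.
move=> ST; split.
- move=> t ht; have rt := cmod_rt ht.
  apply: differentiable_linfracZ; apply: den_neq0 => //.
  by rewrite mulNr cmodN.
- by move=> _ [t ht <-]; exact: product_disc_in.
- by rewrite /product_disc !linfrac0 !scale0r !addr0.
- rewrite derive1_linfracZ -scalerBr; congr (_ *: _).
  rewrite /r /ec -[2](rmorph_nat (real_complex R)) -!rmorphM /=.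
  by congr (_%:C)%C; field.
Qed.

(** The Cayley transform (l - e) / (l + e) of l = 1 - <w, q> / <q, q>, computed in block [i0]. There
    l has positive real part on the domain, and l = e at [product_point], where the function
    therefore vanishes. *)
Definition block_fun i0 (w : 'rV[cplx R]_(\sum_i N i)) : cplx R :=
  (1 - hdot (submxrow w i0) (q i0) / hdot (q i0) (q i0) - ec) /
  (1 - hdot (submxrow w i0) (q i0) / hdot (q i0) (q i0) + ec).

Lemma cayley_half (l : cplx R) : 0 < complex.Re l -> l + ec != 0 /\
  unit_disc ((l - ec) / (l + ec)).
Proof.
move=> l0; have h : cmod (l - ec) < cmod (l + ec).
  apply: cmod_lt; rewrite !cReD !cImD !cReN !cImN /= oppr0.
  by have := mulr_gt0 l0 e0; lra.
have c0 : 0 < cmod (l + ec) by apply: le_lt_trans h; exact: cmod_ge0.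
split; first by apply/eqP => h0; move: c0; rewrite h0 cmod0 ltxx.
rewrite unit_discE -[X in X < _]mulr1 -[X in _ * X](divff (lt0r_neq0 c0)).
have -> : cmod ((l - ec) / (l + ec)) = cmod (l - ec) / cmod (l + ec).
  by apply: complexI; rewrite rmorphM fmorphV /= !cmodE normrM normfV.
by rewrite divff ?lt0r_neq0 // mulr1 ltr_pdivrMr // mul1r.
Qed.

Lemma differentiable_hdot_block i0 (v : 'rV[cplx R]_(N i0)) w :
  differentiable (fun w : 'rV[cplx R]_(\sum_i N i) => hdot (submxrow w i0) v) w.
Proof.
have -> : (fun w : 'rV[cplx R]_(\sum_i N i) => hdot (submxrow w i0) v) =
  \sum_(j < N i0) (fun w : 'rV[cplx R]_(\sum_i N i) => w 0 (tagnat.Rank i0 j) * (v 0 j)^*).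
  by apply/funext => u; rewrite fct_sumE; apply: eq_bigr => j _; rewrite mxE.
apply: differentiable_sum => j; apply: differentiableM; first exact: differentiable_coord.
exact: differentiable_cst.
Qed.

Lemma block_fun_bounded i0 : is_bounded_fun (product_domain D) (block_fun i0).
Proof.
split; last first.
  by move=> _ [w Dw <-]; have [] := cayley_half (half (Dw i0)).
move=> w Dw; have [d0 _] := cayley_half (half (Dw i0)).
have dh : differentiable (fun w : 'rV[cplx R]_(\sum_i N i) =>
    1 - hdot (submxrow w i0) (q i0) / hdot (q i0) (q i0)) w.
  apply: differentiableB; first exact: differentiable_cst.
  apply: differentiableM; last exact: differentiable_cst.
  exact: differentiable_hdot_block.
exact: differentiable_cayley.
Qed.

Lemma linfrac_half (K : numFieldType) (x t : K) : x != 0 ->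
  (1 - (1 - x + t) - x) / (1 - (1 - x + t) + x) = linfrac (- (2 * x)^-1) t * (- (2 * x)^-1).
Proof.
move=> x0; have -> : 1 - (1 - x + t) - x = - t by ring.
have -> : 1 - (1 - x + t) + x = (2 * x) * (1 + - (2 * x)^-1 * t).
  by field; rewrite ?x0.
by rewrite invfM /linfrac mulrN mulNr mulrCA mulrC.
Qed.

Lemma product_point_in : product_domain D product_point.
Proof.
have := @product_disc_in pred0 pred0 (fun _ => isT) 0 (@disc0 R).
by rewrite /product_disc !linfrac0 !scale0r !addr0.
Qed.

Lemma diff_block_fun i0 :
  'd (block_fun i0) product_point (block_vec (pred1 i0)) = - (2 * ec)^-1.
Proof.
apply: (@diff_along_line _ _ _ _ _ _ (- (2 * ec)^-1)).
  exact: (block_fun_bounded i0).1 product_point_in.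
move=> t; rewrite /block_fun submxrowD submxrowZ !mxrowK /= eqxx -scalerDl hdotZl.
have q1 : hdot (q i0) (q i0) != 0 by apply: contra_neq (q0 i0); exact: hsq_eq0.
rewrite mulfK // linfrac_half //.
by rewrite /ec (fmorph_eq0 (real_complex R)) lt0r_neq0.
Qed.

Variable F : forall n, set 'rV[cplx R]_n -> 'rV[cplx R]_n -> 'rV[cplx R]_n -> R.
Hypothesis hF : sandwiched F.

Let P := product_domain D.

Lemma product_metric_le S T : (forall i, ~~ (S i && T i)) ->
  0 <= F P product_point (block_vec S - block_vec T) <= (3 / 2 * e)^-1.
Proof.
move=> ST; have a0 : 0 < 3 / 2 * e by rewrite mulr_gt0 // divr_gt0.
have hd := product_disc_is_disc ST; rewrite (hF.1 _ _ _ _ _ _ a0 hd) andbT.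
have h0 : is_bounded_fun P (cst 0).
  split; first by move=> w _; exact: differentiable_cst.
  by move=> _ [w _ <-]; exact: disc0.
exact: le_trans (cmod_ge0 _) (hF.2 _ _ _ _ _ _ _ a0 hd h0).
Qed.

Lemma product_metric_ge i0 : (2 * e)^-1 <= F P product_point (block_vec (pred1 i0)).
Proof.
have a0 : 0 < 3 / 2 * e by rewrite mulr_gt0 // divr_gt0.
(* This disc only supplies the existence required by the second half of the sandwich; the value of
   the bound comes from [block_fun]. *)
have hd := @product_disc_is_disc (pred1 i0) pred0 (fun i => negbT (andbF _)).
have := hF.2 _ _ _ _ _ _ _ a0 hd (block_fun_bounded i0).
have -> : block_vec pred0 = 0 by exact: mxrow0.
rewrite subr0 diff_block_fun cmodN.
suff -> : cmod (2 * ec)^-1 = (2 * e)^-1 by [].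
have -> : (2 * ec)^-1 = (((2 * e)^-1)%:C)%C by rewrite fmorphV rmorphM /= rmorph_nat.
by rewrite cmod_real gtr0_norm // invr_gt0 mulr_gt0.
Qed.

End ProductWitnesses.

(** * Isometries *)

Lemma diff_near_inverse (R : numFieldType) (V W : normedModType R)
    (f : V -> W) (g : W -> V) y :
  differentiable g y -> differentiable f (g y) -> (\near y, f (g y) = y) ->
  forall w, 'd f (g y) ('d g y w) = w.
Proof.
move=> dg df fg w; have dfg : differentiable (f \o g) y by exact: differentiable_comp.
transitivity ('D_w (f \o g) y).
  by rewrite (deriveE w dfg) (diff_comp dg df).
have -> : 'D_w (f \o g) y = 'D_w id y by apply: near_eq_derive; exact: fg.
exact: derive_id.
Qed.

Section Differential.
Variable R : realType.

Lemma complexifyD n (x y : 'rV[R]_(n + n)) :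
  complexify (x + y) = complexify x + complexify y.
Proof. by apply: (can_inj (@realifyK R n)); rewrite realifyD !complexifyK. Qed.

Lemma complexifyN n (x : 'rV[R]_(n + n)) : complexify (- x) = - complexify x.
Proof. by apply: (can_inj (@realifyK R n)); rewrite realifyN !complexifyK. Qed.

Lemma rdiffD n1 n2 (f : 'rV[cplx R]_n1 -> 'rV[cplx R]_n2) z xi eta :
  rdiff f z (xi + eta) = rdiff f z xi + rdiff f z eta.
Proof. by rewrite /rdiff realifyD linearD complexifyD. Qed.

Lemma rdiffN n1 n2 (f : 'rV[cplx R]_n1 -> 'rV[cplx R]_n2) z xi :
  rdiff f z (- xi) = - rdiff f z xi.
Proof. by rewrite /rdiff realifyN linearN complexifyN. Qed.

(** The differential of the inverse map is a right inverse, because f o g is the identity near f(z),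
    the target being open. *)
Lemma rdiff_surjective n1 n2 (D1 : set 'rV[cplx R]_n1) (D2 : set 'rV[cplx R]_n2) f z :
  open D2 -> C1_diffeo D1 D2 f -> D1 z ->
  forall eta, exists xi, rdiff f z xi = eta.
Proof.
move=> oD2 [g [fD fg [df _] [dg _]]] Dz eta.
have D2fz : D2 (f z) by rewrite -fD; exists z.
have gfz : g (f z) = z by apply: fg; rewrite inE.
exists (rdiff g (f z) eta); rewrite /rdiff complexifyK.
have rz : realmap g (realify (f z)) = realify z.
  by rewrite /realmap /= realifyK gfz.
have := @diff_near_inverse _ _ _ (realmap f) (realmap g) (realify (f z)).
rewrite rz => -> //; first exact: realifyK.
- by apply: dg; exact/realset_realify.
- by apply: df; exact/realset_realify.
- have : nbhs (realify (f z)) (realset D2).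
    by apply: open_nbhs_nbhs; split; [exact: realset_open|exact/realset_realify].
  apply: filterS => y; rewrite /realset /= -fD => -[x Dx fx].
  by rewrite /realmap /= realifyK -fx fg ?inE // fx complexifyK.
Qed.

Lemma product_domain_open m (N : 'I_m -> nat) (D : forall i, set 'rV[cplx R]_(N i)) :
  (forall i, open (D i)) -> open (product_domain D).
Proof.
move=> oD; rewrite openE => z Dz.
have : \forall w \near z, forall i, D i (submxrow w i).
  apply: (@filter_forall _ _ (fun i w => D i (submxrow w i)) (nbhs z)) => i.
  have : nbhs (submxrow z i) (D i) by exact: open_nbhs_nbhs.
  move=> /nbhs_ballP[e /= e0 he]; change (nbhs z [set w | D i (submxrow w i)]).
  apply/nbhs_ballP; exists e => // w [_ hw].
  by apply: he; split=> // a b; rewrite !mxE; exact: hw.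
by [].
Qed.

(** The right side of the parallelogram law is at least x^2, the left side at most (8/9) x^2. The
    lemma is used with x = 1 / e. *)
Lemma parallelogram_contradiction (x a b c d : R) : 0 < x ->
  b ^+ 2 + a ^+ 2 = 2 * d ^+ 2 + 2 * c ^+ 2 -> x / 2 <= d -> x / 2 <= c ->
  0 <= a <= 2 / 3 * x -> 0 <= b <= 2 / 3 * x -> False.
Proof.
move=> x0 par dx cx /andP[a0 ax] /andP[b0 bx].
have b1 : x / 2 * (x / 2) <= d * d by apply: ler_pM => //; lra.
have b2 : x / 2 * (x / 2) <= c * c by apply: ler_pM => //; lra.
have b3 : a * a <= 2 / 3 * x * (2 / 3 * x) by apply: ler_pM.
have b4 : b * b <= 2 / 3 * x * (2 / 3 * x) by apply: ler_pM.
have : 0 < x * x by exact: mulr_gt0.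
by rewrite !expr2 in par; lra.
Qed.

Lemma no_isometry (F : forall n, set 'rV[cplx R]_n -> 'rV[cplx R]_n -> 'rV[cplx R]_n -> R)
  (m n : nat) (N : 'I_m -> nat) (D : forall i, set 'rV[cplx R]_(N i)) (k : nat) f :
  sandwiched F -> (2 <= m)%N -> (forall i, (1 <= N i)%N) ->
  (forall i, is_domain (D i)) -> (forall i, bounded_set (D i)) ->
  (forall i, smooth_boundary k.+1 (D i)) ->
  ~ C1_isometry F (@unit_ball R n) (product_domain D) f.
Proof.
move=> hF hm hN hdom hbnd hsm [hf iso].
pose tp i := cid (touching_point (hN i) (hdom i) (hbnd i) (hsm i)).
pose q i := sval (tp i).
have q0 i : q i != 0 by have [] := svalP (tp i).
have half i w : D i w -> 0 < complex.Re (1 - hdot w (q i) / hdot (q i) (q i)).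
  by have [_ h _] := svalP (tp i); exact: h.
have sec i : exists e0 : R, 0 < e0 /\ forall (e : R) (c : cplx R), 0 < e < e0 ->
    cmod c <= 7 -> 7^-1 <= complex.Re c -> D i (q i - (e%:C)%C *: (c *: q i)).
  have [_ _ h] := svalP (tp i).
  have [|e0 e00 he] := h 7 7^-1; first by rewrite invr_gt0.
  by exists e0.
have [e0 he0] := choice sec.
(* One scale must work in all the factors at once: the minimum of the thresholds and 1, halved below
   to get a strict inequality. *)
pose e1 := \big[Num.min/1]_i e0 i.
have e10 : 0 < e1 by apply: lt_bigmin => // i _; have [] := he0 i.
have hlt (x : R) : 0 < x -> x / 2 < x by lra.
pose e := e1 / 2; have ep : 0 < e by rewrite divr_gt0.
have sector i (c : cplx R) : cmod c <= 7 -> 7^-1 <= complex.Re c ->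
    D i (q i - (e%:C)%C *: (c *: q i)).
  apply: (he0 i).2; rewrite ep /=; exact: lt_le_trans (hlt _ e10) (bigmin_le _ i e0).
pose p := product_point q e.
have : product_domain D p by exact: product_point_in sector.
have [g [fD _ _ _]] := hf; rewrite -{1}fD => -[z Bz fz].
have oP : open (product_domain D) by apply: product_domain_open => i; have [] := hdom i.
have surj := rdiff_surjective oP hf Bz.
pose i1 : 'I_m := Ordinal (ltnW hm); pose i2 : 'I_m := Ordinal hm.
have [xi1 h1] := surj (block_vec q (pred1 i1)).
have [xi2 h2] := surj (block_vec q (pred1 i2)).
(* The law holds at z for the preimages of q_1 and q_2 under the differential; by additivity of the
   differential, [iso] moves it to the product. *)
have par := ball_parallelogram Bz hF xi1 xi2.
rewrite -!iso // rdiffD rdiffD rdiffN h1 h2 fz in par.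
have L1 := product_metric_ge ep q0 half sector hF i1.
have L2 := product_metric_ge ep q0 half sector hF i2.
have U1 : 0 <= F _ (product_domain D) p
    (block_vec q (pred1 i1) - block_vec q (pred1 i2)) <= (3 / 2 * e)^-1.
  by apply: (product_metric_le ep sector hF) => i /=; apply/negP => /andP[/eqP -> ].
have U2 : 0 <= F _ (product_domain D) p
    (block_vec q (pred1 i1) + block_vec q (pred1 i2)) <= (3 / 2 * e)^-1.
  (* For the sum both blocks go into S and T is empty, so the two block discs turn the same way. *)
  have -> : block_vec q (pred1 i1) + block_vec q (pred1 i2) =
      block_vec q (predU (pred1 i1) (pred1 i2)) - block_vec q pred0.
    rewrite [block_vec q pred0]mxrow0 subr0 /block_vec -mxrowD; apply: eq_mxrow => i /=.
    case: (boolP (i == i1)) => [/eqP ->|_] /=; last by rewrite add0r.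
    by rewrite addr0.
  by apply: (product_metric_le ep sector hF) => i /=; rewrite andbF.
have E1 : (2 * e)^-1 = e^-1 / 2 by rewrite invfM mulrC.
have E2 : (3 / 2 * e)^-1 = 2 / 3 * e^-1 by rewrite invfM invf_div.
have x0 : 0 < e^-1 by rewrite invr_gt0.
rewrite E1 in L1 L2; rewrite E2 in U1 U2.
exact: (parallelogram_contradiction x0 par L1 L2 U1 U2).
Qed.

End Differential.

Theorem theorem1p3 (R : realType) (m n : nat) (N : 'I_m -> nat)
  (D : forall i : 'I_m, set 'rV[cplx R]_(N i))
  (hm : (2 <= m)%N) (hmn : (m <= n)%N)
  (hN : forall i, (1 <= N i)%N)
  (hn : n = (\sum_(i < m) N i)%N)
  (hdom : forall i, is_domain (D i))
  (hbnd : forall i, bounded_set (D i))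
  (hC6 : forall i, smooth_boundary 6 (D i))
  (hconv : forall i, strongly_convex (D i)) :
  ~ (exists f, C1_kobayashi_isometry (@unit_ball R n) (product_domain D) f) /\
  ~ (exists f, C1_caratheodory_isometry (@unit_ball R n) (product_domain D) f).
Proof.
split=> -[f hf].
  exact: (no_isometry (@kobayashi_sandwiched R) hm hN hdom hbnd hC6 hf).
exact: (no_isometry (@caratheodory_sandwiched R) hm hN hdom hbnd hC6 hf).
Qed.
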